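(* Let $n\geq1$. If $T$ is a non standard tableau with two rows, both of which are standard rows in the alphabet $\{1,\dots,n\}$, then the shuffling polynomial $\Theta(T)\in S^2\mathsf{A}_1$ is an element of $\mathcal{K}$, the kernel of the multiplication map $S^2\mathsf{A}_1\to\mathsf{A}_2$.
   Context: Rows and tableaux. A row is a finite (possibly empty) sequence $I=i_1\cdots i_r$ of integers in $\{1,\dots,n\}$; $|I|=r$; $IJ$ is concatenation; set-theoretic notation is applied to rows via their entries. A row is standard if its entries are strictly increasing. For a row $I$ with distinct entries, $I^{\leq}$ is the increasing rearrangement and $\varepsilon(I)$ is the sign of the permutation sorting $I$ into $I^\leq$. Order on standard rows: $i_1\cdots i_r\leq j_1\cdots j_s$ if $r\geq s$ and $i_m\leq j_m$ for $1\leq m\leq s$. A tableau with two rows is a pair $\binom{R_1}{R_2}$ of rows with $|R_1|\geq|R_2|$; it is standard if both rows are standard and $R_1\leq R_2$. The spin module. Let $V=\mathbb{C}^{2n+2}$ with the symmetric bilinear form with matrix $\left(\begin{smallmatrix}0&\mathrm{Id}\\ \mathrm{Id}&0\end{smallmatrix}\right)$, $\mathfrak{g}=\mathfrak{so}(2n+2)$ its orthogonal Lie algebra, $G=\mathrm{Spin}(2n+2)$. Chevalley generators: $e_i=\left(\begin{smallmatrix}E_{i,i+1}&0\\0&-E_{i+1,i}\end{smallmatrix}\right)$ for $1\leq i\leq n$, $e_{n+1}=\left(\begin{smallmatrix}0&E_{n,n+1}-E_{n+1,n}\\0&0\end{smallmatrix}\right)$, $f_i=e_i^t$, $h_i=[e_i,f_i]$;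 $\omega_{n+1}$ is the fundamental weight dual to $h_{n+1}$. The positive spin module $\mathbb{S}$ has basis $x(I)$, $I$ a standard row in $\{1,\dots,n\}$, and action: for $1\leq i\leq n-1$, $e_i x(I)=x(I')$, with $I'$ obtained from $I$ by replacing $i+1$ by $i$, if $i+1\in I$, $i\notin I$, and $0$ otherwise; $e_n x(I)=x(In)$ if $n\notin I$ and $|I|$ odd, $0$ otherwise; $e_{n+1}x(I)=x(In)$ if $n\notin I$ and $|I|$ even, $0$ otherwise; for $1\leq i\leq n-1$, $f_i x(I)=x(I'')$, with $I''$ obtained by replacing $i$ by $i+1$, if $i\in I$, $i+1\notin I$, and $0$ otherwise; $f_nx(I)=x(I\setminus\{n\})$ if $n\in I$ and $|I|$ even, $0$ otherwise; $f_{n+1}x(I)=x(I\setminus\{n\})$ if $n\in I$ and $|I|$ odd, $0$ otherwise. It is irreducible, isomorphic to $V_{\omega_{n+1}}^*$. Extend $x$ to all rows by $x(I)=\varepsilon(I)x(I^\leq)$ if $I$ has distinct entries and $x(I)=0$ otherwise, and set $x\binom{I}{J}=x(I)x(J)\in S^2\mathbb{S}$. The Lagrangian grassmannian. $\mathcal{G}r$ is the variety of $(n+1)$-dimensional totally isotropic subspaces of $V$ whose intersection with the span $V_2$ of the last $n+1$ canonical basis vectors is even dimensional; $\mathcal{L}$ is the ($G$-linearized) line bundle on $\mathcal{G}r$ corresponding to $\omega_{n+1}$ (the ample generator of the Picard group), $\mathsf{A}_m=H^0(\mathcal{G}r,\mathcal{L}^m)$. One has $\mathsf{A}_1\simeq\mathbb{S}$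 as $G$-modules (uniquely up to scalar) and $\mathsf{A}_1$ is identified with $\mathbb{S}$; $\mathcal{K}=\ker(S^2\mathsf{A}_1\to\mathsf{A}_2)$. Shuffling polynomial. A non standard tableau $T$ with two standard rows can be written uniquely in canonical form $T=\binom{IJ}{HK}$: for some $r\geq0$, $|I|=r$, $|H|=r+1$, the $m$-th entry of $I$ is $\leq$ the $m$-th entry of $H$ for $1\leq m\leq r$, and the first entry of $J$ is greater than the last entry of $H$. Put $Z_1=I\cap H$, $Z_2=J\cap K$ as increasing rows. Then $$\Theta(T)=\sum(-1)^{\frac{h(h+1)}2}{|J\setminus K|+h\brack h}_{-1}\varepsilon(H'J')\varepsilon(Z_2K_1')\,x\binom{IJ'K_1'}{H'K_2'},\quad h=|H|-|H'|,$$ the sum running over all quadruples $(J',H',K_1',K_2')$ of standard rows with (1) $|H'|\leq|H|$, (2) $H'\sqcup J'=H\sqcup J$, (3) $K_1'\sqcup K_2'=K$, (4) $Z_1\subset H'$, (5) $Z_2\subset J'\cap K_2'$. Here, for $0\leq k\leq m$, ${m\brack k}_q=\frac{(1-q^m)\cdots(1-q^{m-k+1})}{(1-q^k)\cdots(1-q)}\in\mathbb{C}[q]$ and ${m\brack k}_{-1}$ is its value at $q=-1$. *)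

(* Defs.v *)
From mathcomp Require Import all_boot all_order all_algebra all_fingroup.
From mathcomp Require Import reals complex mpoly.

Set Implicit Arguments.
Unset Strict Implicit.
Unset Printing Implicit Defensive.

Import GRing.Theory.
Local Open Scope ring_scope.

Section Rows.
Variable n : nat.

(* The ordinal [j : 'I_n] stands for the letter [j + 1] of {1, ..., n}. *)
Definition irow := seq 'I_n.
Implicit Types I J H K : irow.

Definition std_row I : bool := sorted (fun a b : 'I_n => (a < b)%N) I.

(* [zip] truncates to the shorter row. *)
Definition entrywise_le I J : bool :=
  all (fun p : 'I_n * 'I_n => (p.1 <= p.2)%N) (zip I J).

Definition le_row I J : bool := (size J <= size I)%N && entrywise_le I J.

Definition is_tableau (T : irow * irow) : bool := (size T.2 <= size T.1)%N.

Definition std_tableau (T : irow * irow) : bool :=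
  [&& is_tableau T, std_row T.1, std_row T.2 & le_row T.1 T.2].

Definition canonical_form (T : irow * irow) I J H K : Prop :=
  [/\ T = (I ++ J, H ++ K), size H = (size I).+1, entrywise_le I H
    & exists j J0 h H0, [/\ J = j :: J0, H = rcons H0 h & (h < j)%N]].

Definition first_violation (T : irow * irow) : nat :=
  find (fun p : 'I_n * 'I_n => (p.2 < p.1)%N) (zip T.1 T.2).

Definition canI (T : irow * irow) : irow := take (first_violation T) T.1.
Definition canJ (T : irow * irow) : irow := drop (first_violation T) T.1.
Definition canH (T : irow * irow) : irow := take (first_violation T).+1 T.2.
Definition canK (T : irow * irow) : irow := drop (first_violation T).+1 T.2.

Lemma canonical_form_exists (T : irow * irow) :
  is_tableau T -> std_row T.1 -> std_row T.2 -> ~~ std_tableau T ->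
  canonical_form T (canI T) (canJ T) (canH T) (canK T).
Proof.
case: T => A B; rewrite /std_tableau /is_tableau /le_row /entrywise_le /=.
move=> sBA -> ->; rewrite sBA /= => nle.
set p := (fun p : 'I_n * 'I_n => (p.2 < p.1)%N).
have hasp : has p (zip A B).
  apply: contraNT nle; rewrite -all_predC; apply: sub_all => x /=.
  by rewrite /p -leqNgt.
rewrite /canonical_form /canI /canJ /canH /canK /first_violation /= -/p.
set r := find p _; have rlt : (r < size (zip A B))%N by rewrite -has_find.
have rB : (r < size B)%N.
  by move: rlt; rewrite size_zip => /leq_trans; apply; exact: geq_minr.
have rA : (r < size A)%N by apply: leq_trans rB sBA.
have [a0 b0] : 'I_n * 'I_n by case: (zip A B) rlt => // x s _; exact: x.
have sA : size (take r A) = r by rewrite size_takel // ltnW.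
split; first by rewrite !cat_take_drop.
- by rewrite sA size_takel.
- rewrite /entrywise_le (take_nth b0 rB) -cats1 -[X in zip X]cats0 zip_cat.
    rewrite all_cat /= andbT; last first.
    apply/(all_nthP (a0, b0)) => i.
    have sB : size (take r B) = r by rewrite size_takel // ltnW.
    rewrite size_zip sA sB minnn => ir; rewrite nth_zip; last by rewrite sA sB.
    rewrite !nth_take //=.
    have := before_find (a0, b0) ir; rewrite nth_zip_cond.
    rewrite (ltn_trans ir rlt) /p /= => /negbT; by rewrite -leqNgt.
  by rewrite sA size_takel // ltnW.
exists (nth a0 A r), (drop r.+1 A), (nth b0 B r), (take r B).
split; [exact: drop_nth | exact: take_nth |].
by have := nth_find (a0, b0) hasp; rewrite nth_zip_cond -/r rlt.
Qed.

Lemma canonical_form_unique (T : irow * irow) I J H K :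
  canonical_form T I J H K ->
  [/\ I = canI T, J = canJ T, H = canH T & K = canK T].
Proof.
case=> -> sH leIH [j [J0 [h [H0 [eJ eH hj]]]]].
have sIH : size I = size H0 by move: sH; rewrite eH size_rcons => -[].
have r_eq : first_violation (I ++ J, H ++ K) = size I.
  rewrite /first_violation /= eJ eH cat_rcons zip_cat // find_cat ifN.
    by rewrite /= hj addn0 size_zip -sIH minnn.
  rewrite -all_predC.
  move: leIH; rewrite /entrywise_le eH -cats1 -[X in zip X]cats0 zip_cat //.
  rewrite all_cat => /andP[/allP le_ _]; apply/allP => y.
  by rewrite ?cats0 => /le_; rewrite /= -leqNgt.
rewrite /canI /canJ /canH /canK r_eq /=.
by rewrite take_size_cat // drop_size_cat // -sH take_size_cat // drop_size_cat.
Qed.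

End Rows.

Section SpinGroup.
Variables (F : fieldType) (n : nat).

(* elem_mx k l is the elementary matrix with 1-based indices k, l. *)
Definition elem_mx (k l : nat) : 'M[F]_n.+1 :=
  \matrix_(a, b) ((a.+1 == k) && (b.+1 == l))%:R.

Definition form_mx : 'M[F]_(n.+1 + n.+1) := block_mx 0 1%:M 1%:M 0.

(* Chevalley generators e_i, f_i (1 <= i <= n+1) on V. *)
Definition eV (i : nat) : 'M[F]_(n.+1 + n.+1) :=
  if (i <= n)%N then block_mx (elem_mx i i.+1) 0 0 (- elem_mx i.+1 i)
  else block_mx 0 (elem_mx n n.+1 - elem_mx n.+1 n) 0 0.

Definition fV (i : nat) : 'M[F]_(n.+1 + n.+1) := (eV i)^T.

(* A standard row is encoded by the set of its entries. *)
Notation srow := {set 'I_n}.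
Notation dimS := #|{: srow}|.

Definition letter (k : nat) : srow := [set j : 'I_n | j.+1 == k].
Definition has_letter (k : nat) (I : srow) : bool := [exists j in I, j.+1 == k].

(* e_i x(I) = x(I') if [e_row i I = Some I'], and 0 if it is None. *)
Definition e_row (i : nat) (I : srow) : option srow :=
  if (i < n)%N then
    if has_letter i.+1 I && ~~ has_letter i I
    then Some ((I :\: letter i.+1) :|: letter i) else None
  else if i == n then
    if ~~ has_letter n I && odd #|I| then Some (I :|: letter n) else None
  else
    if ~~ has_letter n I && ~~ odd #|I| then Some (I :|: letter n) else None.

Definition f_row (i : nat) (I : srow) : option srow :=
  if (i < n)%N then
    if has_letter i I && ~~ has_letter i.+1 I
    then Some ((I :\: letter i) :|: letter i.+1) else None
  else if i == n then
    if has_letter n I && ~~ odd #|I| then Some (I :\: letter n) else None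
  else
    if has_letter n I && odd #|I| then Some (I :\: letter n) else None.

(* The spin module is 'cV[F]_dimS, with x(I) the basis vector of index
   [enum_rank I]; endomorphisms are matrices acting on columns. *)
Definition row_op (op : srow -> option srow) : 'M[F]_dimS :=
  \matrix_(a, b) (op (enum_val b) == Some (enum_val a))%:R.

Definition eS (i : nat) : 'M[F]_dimS := row_op (e_row i).
Definition fS (i : nat) : 'M[F]_dimS := row_op (f_row i).

(* Spin(2n+2), realized as the subgroup of GL(V) x GL(S) generated by the
   one-parameter subgroups exp(t e_i), exp(t f_i).  The weights of V and S
   together span the whole weight lattice, so that this group is the simply
   connected one.  All the e_i and f_i have square zero on V and on S, so that
   exp(t e_i) = 1 + t e_i. *)
Definition spin_pair : Type := ('M[F]_(n.+1 + n.+1) * 'M[F]_dimS)%type.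

Definition exp_e (i : nat) (t : F) : spin_pair :=
  (1%:M + t *: eV i, 1%:M + t *: eS i).
Definition exp_f (i : nat) (t : F) : spin_pair :=
  (1%:M + t *: fV i, 1%:M + t *: fS i).

Inductive in_spin : spin_pair -> Prop :=
| in_spin_e i t : (1 <= i <= n.+1)%N -> in_spin (exp_e i t)
| in_spin_f i t : (1 <= i <= n.+1)%N -> in_spin (exp_f i t)
| in_spin_one : in_spin (1%:M, 1%:M)
| in_spin_mul g h : in_spin g -> in_spin h -> in_spin (g.1 *m h.1, g.2 *m h.2)
| in_spin_inv g : in_spin g -> in_spin (invmx g.1, invmx g.2).

Definition spin : Type := {g : spin_pair | in_spin g}.

Definition actV (g : spin) : 'M[F]_(n.+1 + n.+1) := (sval g).1.
Definition actS (g : spin) : 'M[F]_dimS := (sval g).2.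

Definition spin_one : spin := exist _ _ in_spin_one.
Definition spin_mul (g h : spin) : spin :=
  exist _ _ (in_spin_mul (svalP g) (svalP h)).
Definition spin_inv (g : spin) : spin := exist _ _ (in_spin_inv (svalP g)).

Lemma index_ok (i : 'I_n.+1) : (1 <= i.+1 <= n.+1)%N.
Proof. by rewrite /= ltn_ord. Qed.

(* The ordinal i stands for the Chevalley index i + 1. *)
Definition xe (i : 'I_n.+1) (t : F) : spin :=
  exist _ _ (in_spin_e t (index_ok i)).
Definition xf (i : 'I_n.+1) (t : F) : spin :=
  exist _ _ (in_spin_f t (index_ok i)).

(* The coroot one-parameter subgroup s |-> w_i(s) w_i(1)^-1, integrating h_i. *)
Definition wei (i : 'I_n.+1) (s : F) : spin :=
  spin_mul (spin_mul (xe i s) (xf i (- s^-1))) (xe i s).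
Definition coroot (i : 'I_n.+1) (s : F) : spin :=
  spin_mul (wei i s) (spin_inv (wei i 1)).

(* Regular functions on the closed subgroup [spin] of SL(V) x SL(S): the
   restrictions of the polynomials in the matrix entries. *)
Definition entries (g : spin) :
    'rV[F]_((n.+1 + n.+1) * (n.+1 + n.+1) + dimS * dimS) :=
  row_mx (mxvec (actV g)) (mxvec (actS g)).

Definition regular_on (P : spin -> Prop) (f : spin -> F) : Prop :=
  exists p : {mpoly F[(n.+1 + n.+1) * (n.+1 + n.+1) + dimS * dimS]},
    forall g, P g -> f g = p.@[fun i => entries g 0 i].

Notation V := 'cV[F]_(n.+1 + n.+1).

Definition bilin (u v : V) : F := (u^T *m form_mx *m v) 0 0.

Definition V1 : {vspace V} := <<[seq delta_mx (lshift n.+1 j) ord0 | j : 'I_n.+1]>>%VS.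
Definition V2 : {vspace V} := <<[seq delta_mx (rshift n.+1 j) ord0 | j : 'I_n.+1]>>%VS.

Definition lagr_gr (W : {vspace V}) : Prop :=
  [/\ \dim W = n.+1, (forall u v, u \in W -> v \in W -> bilin u v = 0)
    & ~~ odd (\dim (W :&: V2))].

Definition act_gr (g : spin) (W : {vspace V}) : {vspace V} :=
  (linfun (mulmx (actV g)) @: W)%VS.

(* The parabolic subgroup stabilizing the base point V1 of the grassmannian. *)
Definition parab (p : spin) : Prop := act_gr p V1 = V1.

(* chi, restricted to [parab], is the character of weight omega_{n+1}. *)
Definition fund_character (chi : spin -> F) : Prop :=
  [/\ regular_on parab chi,
      (forall p q, parab p -> parab q -> chi (spin_mul p q) = chi p * chi q)
    & forall (i : 'I_n.+1) (s : F), s != 0 ->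
        chi (coroot i s) = if i == ord_max then s else 1].

(* Sections of the m-th power of the line bundle of weight omega_{n+1}.  The
   group acts transitively on the grassmannian, so that its points are the
   W = g V1, and g |-> g V1 is a principal bundle with group [parab].  The line
   bundle is the bundle associated with the character chi^-1, and a section is
   a regular function f of the pair (W, g), W = g V1, with
   f(W, g p) = chi(p)^m f(W, g) for p in [parab].  With this sign the sections
   for m = 1 form the dual of the module of highest weight omega_{n+1}. *)
Definition frame (W : {vspace V}) (g : spin) : Prop := act_gr g V1 = W.

Definition section (chi : spin -> F) (m : nat) (f : spin -> F) : Prop :=
  regular_on (fun=> True) f /\
  forall W, lagr_gr W -> forall g p, frame W g -> parab p ->
    f (spin_mul g p) = chi p ^+ m * f g.

Definition zero_section (f : spin -> F) : Prop :=
  forall W, lagr_gr W -> forall g, frame W g -> f g = 0.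

(* phi is an isomorphism of modules under the spin group from the spin module
   onto the module of sections for m = 1, the group acting on sections by
   (g . f)(h) = f(g^-1 h). *)
Definition spin_iso (chi : spin -> F) (phi : 'cV[F]_dimS -> spin -> F) : Prop :=
  [/\ forall a u v h, phi (a *: u + v) h = a * phi u h + phi v h,
      forall v, section chi 1 (phi v),
      forall g v h, phi (actS g *m v) h = phi v (spin_mul (spin_inv g) h),
      forall v, (forall h, phi v h = 0) -> v = 0
    & forall f, section chi 1 f -> exists v, forall h, phi v h = f h].

(* The symmetric algebra of the spin module is the polynomial ring
   {mpoly F[dimS]} in the variables x(I); its second symmetric power is the
   space of homogeneous polynomials of degree 2.  Sections are multiplied
   pointwise. *)
Definition mult_sections (phi : 'cV[F]_dimS -> spin -> F)
    (q : {mpoly F[dimS]}) (h : spin) : F :=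
  q.@[fun i => phi (delta_mx i 0) h].

Definition mult_kernel (phi : 'cV[F]_dimS -> spin -> F) (q : {mpoly F[dimS]}) :
    Prop :=
  q \is 2.-homog /\ zero_section (mult_sections phi q).

End SpinGroup.

Section Shuffling.
Variables (F : fieldType) (n : nat).
Notation srow := {set 'I_n}.
Notation dimS := #|{: srow}|.

(* The sign of the permutation sorting I; it is 0 if I has a repeated entry. *)
Definition eps (I : irow n) : F :=
  if [pick s : 'S_(size I)
      | std_row [seq tnth (in_tuple I) (s i) | i <- enum 'I_(size I)]] is Some s
  then (-1) ^+ odd_perm s else 0.

Definition xrow (I : irow n) : {mpoly F[dimS]} :=
  if uniq I then eps I *: 'X_(enum_rank [set i in I]) else 0.

Definition xT (T : irow n * irow n) : {mpoly F[dimS]} := xrow T.1 * xrow T.2.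

(* For k <= m the division of polynomials is exact. *)
Definition qbinomial (m k : nat) : {poly F} :=
  (\prod_(i < k) (1 - 'X^(m - i))) %/ (\prod_(i < k) (1 - 'X^(i.+1))).

(* The rows J', H', K1', K2' are standard, hence encoded by sets; [enum] lists
   the elements of such a set in increasing order. *)
Definition Theta (T : irow n * irow n) : {mpoly F[dimS]} :=
  let I := canI T in let J := canJ T in
  let H := canH T in let K := canK T in
  let Z1 : srow := [set i in I] :&: [set i in H] in
  let Z2 : srow := [set i in J] :&: [set i in K] in
  \sum_(J' : srow) \sum_(H' : srow) \sum_(K1' : srow) \sum_(K2' : srow |
      [&& (#|H'| <= size H)%N,
          [disjoint H' & J'] && (H' :|: J' == [set i in H] :|: [set i in J]),
          [disjoint K1' & K2'] && (K1' :|: K2' == [set i in K]),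
          Z1 \subset H'
        & Z2 \subset J' :&: K2'])
    let h := (size H - #|H'|)%N in
    ((-1) ^+ ((h * h.+1) %/ 2)
     * (qbinomial (#|[set i in J] :\: [set i in K]| + h) h).[-1]
     * eps (enum H' ++ enum J') * eps (enum Z2 ++ enum K1'))
    *: xT (I ++ enum J' ++ enum K1', enum H' ++ enum K2').

End Shuffling.

(* Main.v *)
(* By the isomorphism phi, the values of the basis x(I) at a point h are, up to
   a scalar, the coordinates of a spinor t in the orbit of the linear form dual
   to x(emptyset).  Such a t is pure: Omega(t, t) = 0, where Omega is the sum of
   gamma_w (x) gamma_w* over a hyperbolic basis of the quadratic space, which
   commutes with the group.  When t(emptyset) <> 0, this relation at the sets A
   and {i} is the expansion of a pfaffian along i, so that contracting t by i
   amounts to wedging it with vectors.  The shuffles of t with itself then reduce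
   to Gaussian binomials at q = -1, and the relation with K empty to an identity
   between those.  The hypothesis t(emptyset) <> 0 is removed by moving t along
   one-parameter groups, and the letters of K are brought in by the derivations
   x(A) |-> x(Ak): once for a letter of K outside J, twice for a letter of both. *)

(* Why q = -1: if t(emptyset) = 1, then t is the exponential of a two-form w in n + 1 letters, the
   last letter being added to the sets of odd size. Since exp(xw) exp(yw) = exp((x+y)w), shuffling t
   with itself produces binomials in numbers of pairs. If the shuffled set is even and its parts are
   odd, both factors contain the last letter and the sum cancels. These are the Gaussian binomials
   at -1. The last letter also explains the minus sign in [omega]: contracting it crosses an odd
   number of letters. The obstacle is the prefix I, present in one row only. It amounts to |I|
   contractions of one factor, hence to as many wedges, each of which takes a letter out of the
   shuffled set and shifts the coefficients. The coefficients must therefore satisfy |I| + 1 linear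
   conditions instead of one. They do because |H| = |I| + 1, and because a shifted sequence of
   coefficients is again a combination of such sequences, by the Gaussian Pascal rule. *)
Require Import Defs.
From HB Require Import structures.
From mathcomp Require Import all_boot all_order all_algebra all_fingroup.
From mathcomp Require Import reals complex mpoly ring zify.

Set Implicit Arguments.
Unset Strict Implicit.
Unset Printing Implicit Defensive.

Import GRing.Theory.
Local Open Scope ring_scope.

(** * Clifford modules and pure spinors *)

Section Clifford.
Variables (F : fieldType) (I : finType) (V : lmodType F).
Implicit Types (a b : I -> {linear V -> V}) (P : bool -> {linear V -> V}).
Implicit Types (f g : {scalar V}) (u v w : V).

Record clifford a b P : Prop := Clifford {
  cl_aa : forall k l v, a k (a l v) = - a l (a k v);
  cl_bb : forall k l v, b k (b l v) = - b l (b k v);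
  cl_aa0 : forall k v, a k (a k v) = 0;
  cl_bb0 : forall k v, b k (b k v) = 0;
  cl_ab : forall k l v, a k (b l v) = v *+ (k == l) - b l (a k v);
  cl_Pa : forall p k v, P p (a k v) = a k (P (~~ p) v);
  cl_Pb : forall p k v, P p (b k v) = b k (P (~~ p) v);
  cl_PP : forall p q v, P p (P q v) = P p v *+ (p == q);
  cl_PD : forall v, P true v + P false v = v }.

Lemma clifford_swap a b P : clifford a b P -> clifford b a P.
Proof.
case=> aa bb aa0 bb0 ab Pa Pb PP PD; split=> // k l v.
by rewrite ab eq_sym opprB addrC subrK.
Qed.

(* a and b are the two halves of a hyperbolic basis of the quadratic space, minus
   one pair, which acts by the parity projections once both half-spin modules are
   identified with the whole exterior algebra. *)
Definition omega a b P f g u v : F :=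
  \sum_k (f (a k u) * g (b k v) + f (b k u) * g (a k v))
  - (f (P true u) * g (P false v) + f (P false u) * g (P true v)).

Definition pure a b P u := forall f g, omega a b P f g u u = 0.

Lemma omega_swap a b P f g u v : omega a b P f g u v = omega b a P f g u v.
Proof. by congr (_ - _); apply: eq_bigr => k _; rewrite addrC. Qed.

Lemma pure_swap a b P u : pure a b P u -> pure b a P u.
Proof. by move=> pu f g; rewrite omega_swap. Qed.

(** Infinitesimal invariance of [omega]: one Lie algebra element acts by [y] on the half-spin module
    of [u] and [v], and by [y'] on the other one, where [f] and [g] are linear forms. *)
Definition skew a b P (y y' : {linear V -> V}) := forall f g u v,
  omega a b P f g (y u) v + omega a b P f g u (y v) =
  omega a b P (f \o y') g u v + omega a b P f (g \o y') u v.

Lemma omegaDl a b P f g s u v w :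
  omega a b P f g (u + s *: v) w = omega a b P f g u w + s * omega a b P f g v w.
Proof.
rewrite /omega !linearD !linearZ /= mulrBr mulr_sumr addrACA -big_split /=.
rewrite -opprD; congr (_ - _); last by ring.
by apply: eq_bigr => k _; rewrite !linearD !linearZ /=; ring.
Qed.

Lemma omegaDr a b P f g s u v w :
  omega a b P f g w (u + s *: v) = omega a b P f g w u + s * omega a b P f g w v.
Proof.
rewrite /omega !linearD !linearZ /= mulrBr mulr_sumr addrACA -big_split /=.
rewrite -opprD; congr (_ - _); last by ring.
by apply: eq_bigr => k _; rewrite !linearD !linearZ /=; ring.
Qed.

Lemma omega0l a b P f g w : omega a b P f g 0 w = 0.
Proof.
rewrite /omega big1 => [|k _]; rewrite !linear0 ?mul0r ?addr0 ?subr0 //.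
Qed.

Lemma omega0r a b P f g w : omega a b P f g w 0 = 0.
Proof.
rewrite /omega big1 => [|k _]; rewrite !linear0 ?mulr0 ?addr0 ?subr0 //.
Qed.

(** As y squares to zero, 1 + s y is an exponential. Invariance at (u, u) kills the term linear in
    s. For the quadratic term, invariance at (y u, u) and at (u, y u) is added up: twice the term is
    then a sum of linear terms for the forms composed with [y']. *)
Lemma pure_step a b P (y y' : {linear V -> V}) (s : F) u :
  (2 : F) != 0 -> skew a b P y y' -> (forall v, y (y v) = 0) ->
  pure a b P u -> pure a b P (u + s *: y u).
Proof.
move=> n2 sk yy pu f g.
have E0 : omega a b P f g (y u) u + omega a b P f g u (y u) = 0.
  by rewrite sk !pu addr0.
have E1 := sk f g (y u) u; have E2 := sk f g u (y u).
rewrite yy omega0l add0r in E1; rewrite yy omega0r addr0 in E2.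
have /eqP : 2 * omega a b P f g (y u) (y u) = 0.
  rewrite mulr_natl mulr2n {1}E1 E2.
  have S1 := sk (f \o y') g u u; have S2 := sk f (g \o y') u u.
  by rewrite addrACA S1 S2 !pu !addr0.
rewrite mulf_eq0 (negPf n2) /= => /eqP E3.
by rewrite omegaDl !omegaDr E3 pu add0r mulr0 addr0 -mulrDr addrC E0 mulr0.
Qed.

Section Generators.
Variables (a b : I -> {linear V -> V}) (P : bool -> {linear V -> V}).
Hypothesis cl : clifford a b P.

Lemma sum_delta (G : I -> F) c : \sum_k G k *+ (k == c) = G c.
Proof.
rewrite (bigD1 c) //= eqxx big1 ?addr0 // => k /negPf ->.
by rewrite mulr0n.
Qed.

Lemma skew_ba c d : c != d -> skew a b P (b d \o a c) (b d \o a c).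
Proof.
move=> ncd f g u v; rewrite /omega /=.
have E1 w k : a k (b d (a c w)) = a c w *+ (k == d) + b d (a c (a k w)).
  by rewrite (cl_ab cl) (cl_aa cl k c) linearN opprK.
have E2 w k : b k (b d (a c w)) = b d (a c (b k w)) - b d w *+ (k == c).
  rewrite (cl_bb cl) [a c (b k w)](cl_ab cl) linearB [c == k]eq_sym.
  by rewrite addrAC linearMn subrr sub0r.
have E3 w p : P p (b d (a c w)) = b d (a c (P p w)).
  by rewrite (cl_Pb cl) (cl_Pa cl) negbK.
rewrite !E3.
have sumE : \sum_k ((f (a k (b d (a c u))) * g (b k v) + f (b k (b d (a c u))) * g (a k v))
     + (f (a k u) * g (b k (b d (a c v))) + f (b k u) * g (a k (b d (a c v))))) =
   \sum_k ((f (b d (a c (a k u))) * g (b k v) + f (b d (a c (b k u))) * g (a k v))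
     + (f (a k u) * g (b d (a c (b k v))) + f (b k u) * g (b d (a c (a k v))))).
  (* The terms left over by the commutators [E1] and [E2] live at k = d and at k = c respectively.
     They cancel because [X1 d] and [X2 c] coincide. *)
  pose X1 k := f (a c u) * g (b k v) + f (b k u) * g (a c v).
  pose X2 k := f (b d u) * g (a k v) + f (a k u) * g (b d v).
  have -> : \sum_k ((f (b d (a c (a k u))) * g (b k v) + f (b d (a c (b k u))) * g (a k v))
     + (f (a k u) * g (b d (a c (b k v))) + f (b k u) * g (b d (a c (a k v))))) =
   \sum_k ((f (b d (a c (a k u))) * g (b k v) + f (b d (a c (b k u))) * g (a k v))
     + (f (a k u) * g (b d (a c (b k v))) + f (b k u) * g (b d (a c (a k v)))))
   + (\sum_k X1 k *+ (k == d) - \sum_k X2 k *+ (k == c)).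
    by rewrite !sum_delta /X1 /X2; ring.
  rewrite -sumrB -big_split; apply: eq_bigr => k _ /=.
  rewrite !E1 !E2 !linearD !linearN /X1 /X2.
  case: (k == d); case: (k == c); rewrite ?mulr1n ?mulr0n ?linear0 /=; ring.
rewrite !big_split /= in sumE; rewrite addrACA [RHS]addrACA; congr (_ + _).
by rewrite !big_split /=.
Qed.

(** Commuting [b c] with [a c] leaves terms pairing [P p] with [b c]; the parity part of [omega],
    once [b c] is split by [cl_PD], compensates them. *)
Lemma skew_bP c p : skew a b P (b c \o P p) (-%R \o (b c \o P (~~ p))).
Proof.
move=> f g u v; rewrite /omega /=.
have E1 w k : a k (b c (P p w)) = P p w *+ (k == c) - b c (P (~~ p) (a k w)).
  by rewrite (cl_ab cl) (cl_Pa cl) negbK.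
have E2 w k : b k (b c (P p w)) = - b c (P (~~ p) (b k w)).
  by rewrite (cl_bb cl) (cl_Pb cl) negbK.
have sumE : \sum_k ((f (a k (b c (P p u))) * g (b k v) + f (b k (b c (P p u))) * g (a k v))
     + (f (a k u) * g (b k (b c (P p v))) + f (b k u) * g (a k (b c (P p v))))) =
   \sum_k ((f (- b c (P (~~ p) (a k u))) * g (b k v) + f (- b c (P (~~ p) (b k u))) * g (a k v))
     + (f (a k u) * g (- b c (P (~~ p) (b k v))) + f (b k u) * g (- b c (P (~~ p) (a k v)))))
   + (f (P p u) * g (b c v) + f (b c u) * g (P p v)).
  rewrite -(sum_delta (fun k => f (P p u) * g (b k v) + f (b k u) * g (P p v))).
  rewrite -big_split; apply: eq_bigr => k _ /=; rewrite !E1 !E2 !linearD !linearN.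
  by case: (k == c); rewrite ?mulr1n ?mulr0n ?linear0 /=; ring.
rewrite !big_split /= in sumE.
rewrite addrACA [RHS]addrACA !big_split /= {}sumE -[LHS]addrA; congr (_ + _).
have E3 w : b c w = b c (P true w) + b c (P false w) by rewrite -linearD (cl_PD cl).
rewrite (E3 u) (E3 v) !(cl_Pb cl) !linearD !linearN /=.
by case: p {E1 E2}; rewrite /= !(cl_PP cl) /= ?mulr1n ?mulr0n ?linear0; ring.
Qed.

Lemma ba_sqr c d v : c != d -> b d (a c (b d (a c v))) = 0.
Proof.
by move=> /negPf ncd; rewrite (cl_ab cl) ncd mulr0n sub0r linearN (cl_bb0 cl) oppr0.
Qed.

Lemma bP_sqr c p v : b c (P p (b c (P p v))) = 0.
Proof. by rewrite (cl_Pb cl) (cl_bb0 cl). Qed.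

Lemma pure_ba c d s u : (2 : F) != 0 -> c != d ->
  pure a b P u -> pure a b P (u + s *: b d (a c u)).
Proof.
move=> n2 ncd; apply: (pure_step _ n2 (skew_ba ncd)) => v; exact: ba_sqr.
Qed.

Lemma pure_bP c p s u : (2 : F) != 0 ->
  pure a b P u -> pure a b P (u + s *: b c (P p u)).
Proof. by move=> n2; apply: (pure_step _ n2 (skew_bP c p)) => v; exact: bP_sqr. Qed.

End Generators.

Lemma pure_aP a b P c p s u : clifford a b P -> (2 : F) != 0 ->
  pure a b P u -> pure a b P (u + s *: a c (P p u)).
Proof.
move=> cl n2 pu; apply: pure_swap; apply: pure_bP => //; last exact: pure_swap.
exact: clifford_swap.
Qed.

End Clifford.

(** * Spinors as functions on standard rows *)

Lemma big_disjointU (R : Type) (idx : R) (op : Monoid.com_law idx)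
    (T : finType) (A B : {set T}) (G : T -> R) : [disjoint A & B] ->
  \big[op/idx]_(x in A :|: B) G x =
  op (\big[op/idx]_(x in A) G x) (\big[op/idx]_(x in B) G x).
Proof. by move=> d; rewrite -bigU //; apply: eq_bigl => x; rewrite !inE. Qed.

Section Cross.
Variable n : nat.
Implicit Types A B C : {set 'I_n}.

(** The number of inversions of the row [enum A ++ enum B] between its two halves, so that [sg A B]
    below is a shuffle sign. *)
Definition cross A B : nat := \sum_(x in A) \sum_(y in B) (y < x)%N.

Lemma crossUl A A' B : [disjoint A & A'] ->
  cross (A :|: A') B = (cross A B + cross A' B)%N.
Proof. by move=> d; rewrite /cross big_disjointU. Qed.

Lemma crossUr A B B' : [disjoint B & B'] ->
  cross A (B :|: B') = (cross A B + cross A B')%N.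
Proof.
by move=> d; rewrite /cross -big_split; apply: eq_bigr => x _; rewrite big_disjointU.
Qed.

Lemma cross11 (x y : 'I_n) : cross [set x] [set y] = (y < x)%N.
Proof. by rewrite /cross !big_set1. Qed.

Lemma cross_swap A B : [disjoint A & B] ->
  (cross A B + cross B A = #|A| * #|B|)%N.
Proof.
move=> d; rewrite /cross [X in (_ + X)%N]exchange_big -big_split /=.
rewrite -sum_nat_const; apply: eq_bigr => x xA.
rewrite -big_split -sum1_card; apply: eq_bigr => y yB /=.
have : x != y by apply: contraTneq yB => <-; rewrite (disjointFr d xA).
by rewrite -val_eqE /=; case: ltngtP.
Qed.

Lemma cross_set0l B : cross set0 B = 0%N.
Proof. by rewrite /cross big_set0. Qed.

End Cross.

Lemma scale_regularE (R : nzRingType) (s x : R) : s *: (x : R^o) = s * x.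
Proof. by []. Qed.

Section Spinors.
Variables (F : fieldType) (n : nat).
Notation srow := {set 'I_n}.
Notation spinor := {ffun {set 'I_n} -> F^o}.
Implicit Types (A B : srow) (t u : spinor) (k l : 'I_n).

Lemma scale_ffunE (s : F) t A : (s *: t) A = s * t A.
Proof. by rewrite ffunE. Qed.

Definition sg A B : F := (-1) ^+ cross A B.

Lemma sgUl A A' B : [disjoint A & A'] -> sg (A :|: A') B = sg A B * sg A' B.
Proof. by move=> d; rewrite /sg crossUl // exprD. Qed.

Lemma sgUr A B B' : [disjoint B & B'] -> sg A (B :|: B') = sg A B * sg A B'.
Proof. by move=> d; rewrite /sg crossUr // exprD. Qed.

Lemma sg0l B : sg set0 B = 1.
Proof. by rewrite /sg cross_set0l expr0. Qed.

Lemma sg_sqr A B : sg A B * sg A B = 1.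
Proof. by rewrite -expr2 sqrr_sign. Qed.

Lemma sg_swap A B : [disjoint A & B] ->
  sg A B * sg B A = (-1) ^+ (#|A| * #|B|).
Proof. by move=> d; rewrite -exprD cross_swap. Qed.

Lemma disjoint1 k A : k \notin A -> [disjoint [set k] & A].
Proof. by move=> kA; rewrite disjoints1. Qed.

Lemma sg11 k : sg [set k] [set k] = 1.
Proof. by rewrite /sg cross11 ltnn. Qed.

Lemma sg11_swap k l : k != l -> sg [set l] [set k] = - sg [set k] [set l].
Proof.
move=> kl; apply: (mulfI (x := sg [set k] [set l])); first by rewrite signr_eq0.
rewrite mulrN sg_sqr sg_swap ?cards1 ?expr1 //.
by rewrite disjoints1 inE.
Qed.

Lemma sgD1 k l A : l \in A -> sg [set k] A = sg [set k] [set l] * sg [set k] (A :\ l).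
Proof.
move=> lA; rewrite -{1}(setD1K lA) sgUr // disjoint1 //.
by rewrite !inE eqxx.
Qed.

Definition contr k t : spinor :=
  [ffun A : srow => if k \in A then 0 else sg [set k] A * t (k |: A)].
Definition wedge k t : spinor :=
  [ffun A : srow => if k \in A then sg [set k] A * t (A :\ k) else 0].
Definition par (p : bool) t : spinor :=
  [ffun A : srow => if odd #|A| == p then t A else 0].
Definition coor A t : F := t A.

Lemma contr_is_linear k : linear (contr k).
Proof.
move=> s u v; apply/ffunP => A; rewrite ffunE [RHS]ffunE !scale_ffunE !ffunE.
by case: ifP => _; rewrite ?mulr0 ?addr0 //= scale_regularE; ring.
Qed.
HB.instance Definition _ k :=
  GRing.isLinear.Build F spinor spinor *:%R (contr k) (contr_is_linear k).

Lemma wedge_is_linear k : linear (wedge k).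
Proof.
move=> s u v; apply/ffunP => A; rewrite ffunE [RHS]ffunE !scale_ffunE !ffunE.
by case: ifP => _; rewrite ?mulr0 ?addr0 //= scale_regularE; ring.
Qed.
HB.instance Definition _ k :=
  GRing.isLinear.Build F spinor spinor *:%R (wedge k) (wedge_is_linear k).

Lemma par_is_linear p : linear (par p).
Proof.
move=> s u v; apply/ffunP => A; rewrite !ffunE.
by case: ifP => _; rewrite ?scaler0 ?addr0.
Qed.
HB.instance Definition _ p :=
  GRing.isLinear.Build F spinor spinor *:%R (par p) (par_is_linear p).

Lemma coor_is_scalar A : scalar (coor A).
Proof. by move=> s u v; rewrite /coor !ffunE. Qed.
HB.instance Definition _ A :=
  GRing.isLinear.Build F spinor F *%R (coor A) (coor_is_scalar A).

Definition contrL k : {linear spinor -> spinor} := contr k.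
Definition wedgeL k : {linear spinor -> spinor} := wedge k.
Definition parL p : {linear spinor -> spinor} := par p.

Lemma contrC k l t : contr k (contr l t) = - contr l (contr k t).
Proof.
apply/ffunP => A; rewrite !ffunE !inE [l == k]eq_sym.
have [->|kl] := eqVneq k l; first by rewrite /= !mulr0; case: ifP; rewrite oppr0.
case: (boolP (k \in A)) => kA; case: (boolP (l \in A)) => lA;
  rewrite /= ?mulr0 ?oppr0 //.
by rewrite !sgUr ?disjoint1 // (sg11_swap kl) setUCA; ring.
Qed.

Lemma wedgeC k l t : wedge k (wedge l t) = - wedge l (wedge k t).
Proof.
apply/ffunP => A; rewrite !ffunE !inE [l == k]eq_sym.
have [->|kl] := eqVneq k l; first by rewrite /= !mulr0; case: ifP; rewrite oppr0.
case: (boolP (k \in A)) => kA; case: (boolP (l \in A)) => lA;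
  rewrite /= ?mulr0 ?oppr0 //.
rewrite (sgD1 k lA) (sgD1 l kA) (sg11_swap kl) !setDDl [[set l] :|: _]setUC; ring.
Qed.

Lemma contr_sqr k t : contr k (contr k t) = 0.
Proof.
by apply/ffunP => A; rewrite !ffunE !inE eqxx /= mulr0; case: ifP.
Qed.

Lemma wedge_sqr k t : wedge k (wedge k t) = 0.
Proof.
by apply/ffunP => A; rewrite !ffunE !inE eqxx /= mulr0; case: ifP.
Qed.

Lemma contr_wedge k l t :
  contr k (wedge l t) = t *+ (k == l) - wedge l (contr k t).
Proof.
apply/ffunP => A; rewrite !ffunE !inE [l == k]eq_sym.
have [<-{l}|kl] := eqVneq k l; rewrite /= ?mulr1n ?mulr0n ?ffunE.
  case: ifP => kA; rewrite ?inE ?eqxx /=.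
    by rewrite setD1K // (sgD1 k kA) sg11 mul1r mulrA sg_sqr mul1r subrr.
  by rewrite setU1K ?kA // subr0 mulrA sgUr ?disjoint1 ?kA // sg11 mul1r sg_sqr mul1r.
rewrite sub0r.
case: (boolP (k \in A)) => kA; case: (boolP (l \in A)) => lA;
  rewrite ?inE /= ?mulr0 ?oppr0 //.
have -> : (k |: A) :\ l = k |: A :\ l.
  apply/setP => x; rewrite !inE; case: (x =P l) => [->|] //=.
  by rewrite eq_sym (negPf kl).
rewrite (sgD1 k lA) sgUr ?disjoint1 ?kA // (sg11_swap kl).
have := sg_sqr [set k] [set l]; set x := sg _ [set l] => xx.
transitivity (- (x * x) * (sg [set l] A * (sg [set k] (A :\ l) * t (k |: A :\ l)))).
  by ring.
by rewrite xx; ring.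
Qed.

Lemma par_contr p k t : par p (contr k t) = contr k (par (~~ p) t).
Proof.
apply/ffunP => A; rewrite !ffunE; case: (boolP (k \in A)) => kA /=.
  by rewrite if_same.
by rewrite cardsU1 kA /= eqb_negLR negbK; case: ifP; rewrite ?mulr0.
Qed.

Lemma par_wedge p k t : par p (wedge k t) = wedge k (par (~~ p) t).
Proof.
apply/ffunP => A; rewrite !ffunE; case: (boolP (k \in A)) => kA /=; last first.
  by rewrite if_same.
rewrite (cardsD1 k A) kA add1n /= eqb_negLR.
by case: ifP; rewrite ?mulr0.
Qed.

Lemma par_par p q t : par p (par q t) = par p t *+ (p == q).
Proof.
by apply/ffunP => A; case: p; case: q; rewrite ?mulr0n ?mulr1n !ffunE; case: (odd _).
Qed.

Lemma parD t : par true t + par false t = t.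
Proof. by apply/ffunP => A; rewrite !ffunE; case: (odd _); rewrite ?addr0 ?add0r. Qed.

Lemma spinor_clifford : clifford contrL wedgeL parL.
Proof.
split.
- exact: contrC.
- exact: wedgeC.
- exact: contr_sqr.
- exact: wedge_sqr.
- exact: contr_wedge.
- exact: par_contr.
- exact: par_wedge.
- exact: par_par.
- exact: parD.
Qed.

Definition pure_spinor t := pure contrL wedgeL parL t.

(* Expansion of a pfaffian along the index i. *)
Lemma pure_contr i t : pure_spinor t ->
  t set0 *: contr i t =
  \sum_k (- contr k t [set i]) *: wedge k t + t [set i] *: par false t.
Proof.
move=> pt; apply/ffunP => A.
have : \sum_k (contr k t A * wedge k t [set i] + wedge k t A * contr k t [set i])
  - (par true t A * par false t [set i] + par false t A * par true t [set i]) = 0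
  := pt (coor A : {scalar spinor}) (coor [set i] : {scalar spinor}).
rewrite big_split /=.
have -> : \sum_k contr k t A * wedge k t [set i] = contr i t A * t set0.
  rewrite (bigD1 i) //= big1 => [|k ki].
    by rewrite addr0 [wedge i t _]ffunE set11 setDv sg11 mul1r.
  by rewrite [wedge k t _]ffunE inE (negPf ki) mulr0.
have -> : par false t [set i] = 0 by rewrite ffunE cards1.
have -> : par true t [set i] = t [set i] by rewrite ffunE cards1.
rewrite mulr0 add0r => /eqP; rewrite subr_eq0 => /eqP E.
rewrite ffunE [RHS]ffunE sum_ffunE !scale_ffunE.
rewrite [X in _ + X]mulrC -{}E addrCA -big_split /= big1 => [|k _].
  by rewrite addr0 mulrC.
by rewrite ffunE scale_regularE; ring.
Qed.
End Spinors.

(** * Gaussian binomials at -1 and shuffles of a pure spinor *)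

(* The Gaussian binomial coefficient [m choose k] at q = -1. *)
Definition sbin (m k : nat) : nat :=
  if ~~ odd m && odd k then 0%N else 'C(m./2, k./2).

Arguments sbin : simpl never.

Lemma sbin_small m k : (m < k)%N -> sbin m k = 0%N.
Proof.
rewrite /sbin => mk; case: ifP => // /negbT; rewrite negb_and negbK => h.
by apply: bin_small; lia.
Qed.

Lemma sbinSS m k : sbin m.+2 k.+2 = (sbin m k + sbin m k.+2)%N.
Proof. by rewrite /sbin /= !negbK; case: ifP => // _; rewrite binS addnC. Qed.

Lemma sbin0 m : sbin m 0 = 1%N.
Proof. by rewrite /sbin /= andbF bin0. Qed.

Lemma sbin1 m : sbin m 1 = odd m.
Proof. by rewrite /sbin /= andbT bin0; case: odd. Qed.

Lemma sbin_evenS m k : ~~ odd m ->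
  sbin m.+1 k = if odd k then sbin m k.-1 else sbin m k.
Proof.
move=> em; rewrite /sbin /= em /=; case: ifP => ok /=.
  case: k ok => //= k ek; rewrite (negPf ek) uphalf_half (negPf em) uphalf_half (negPf ek).
  by rewrite !add0n.
by rewrite uphalf_half (negPf em) ok.
Qed.

Lemma sbin_odd_pred m k : odd m -> odd k -> sbin m k.-1 = sbin m k.
Proof.
rewrite /sbin => om; case: k => //= k ek.
by rewrite om /= uphalf_half (negPf ek).
Qed.

Section Weights.
Variable F : fieldType.
Implicit Types c : nat -> F.

Definition shift j c : nat -> F := fun i => c (j + i)%N.
Definition cut (p : bool) c : nat -> F := fun j => if odd j == p then c j else 0.
Definition alter c : nat -> F := fun j => (-1) ^+ j * c j.

Definition weight c m : F := \sum_(j < m.+1) c j * (sbin m j)%:R.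

Lemma weight_widen c m N : (m < N)%N -> weight c m = \sum_(j < N) c j * (sbin m j)%:R.
Proof.
move=> mN; rewrite /weight (big_ord_widen_cond _ xpredT (fun j => c j * (sbin m j)%:R) mN).
rewrite big_mkcond; apply: eq_bigr => j _ /=; rewrite ltnS; case: leqP => // mj.
by rewrite sbin_small // mulr0.
Qed.

Lemma eq_weight c c' m : c =1 c' -> weight c m = weight c' m.
Proof. by move=> e; apply: eq_bigr => j _; rewrite e. Qed.

Lemma weightSS c m : weight c m.+2 = weight (shift 2 c) m + weight c m.
Proof.
rewrite [X in _ = _ + X](@weight_widen c m m.+3); last by lia.
rewrite /weight.
rewrite big_ord_recl [X in _ + X]big_ord_recl [X in _ = _ + X]big_ord_recl.
rewrite [X in _ = _ + (_ + X)]big_ord_recl /= !sbin0 !sbin1 /= negbK.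
rewrite [RHS]addrCA [X in _ = _ + X]addrCA -big_split /=; congr (_ + (_ + _)).
by apply: eq_bigr => j _; rewrite /bump /= !add1n sbinSS natrD mulrDr.
Qed.

(** This accounts for the parity term in the expansion of a contraction of t, which contributes only
    on sets of even size m. *)
Lemma weight_cut c m :
  weight (cut false (shift 1 c)) m + weight (cut (odd m) (alter c)) m =
  if odd m then 0 else weight c m.+1.
Proof.
rewrite (weight_widen _ (N := m.+2)) // (weight_widen (cut (odd m) _) (N := m.+2)) //.
rewrite [X in X + _]big_ord_recr /= [sbin m m.+1]sbin_small // mulr0 addr0.
rewrite [X in _ + X]big_ord_recl /= /cut /= addrCA -big_split /=.
case: (boolP (odd m)) => om.
  rewrite /= mul0r add0r big1 // => j _; rewrite /bump /= add1n /alter /shift add1n /=.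
  case: (boolP (odd j)) => oj; rewrite /= ?mul0r ?addr0 //=.
  by rewrite -(@sbin_odd_pred m j.+1) //= exprS -signr_odd (negPf oj); ring.
rewrite /weight [RHS]big_ord_recl /= !sbin0 /alter expr0 mul1r /=; congr (_ + _).
apply: eq_bigr => j _; rewrite /bump /= !add1n /alter /shift add1n /= sbin_evenS //=.
case: (boolP (odd j)) => oj; rewrite /= ?mul0r ?addr0 ?add0r //=.
by rewrite exprS -signr_odd oj; ring.
Qed.

(** These conditions make the shuffles of t with up to r wedges of t vanish over m letters: each
    wedge uses up one letter and shifts [c] by one, and all lower numbers of wedges can occur. *)
Definition annihilates r m c :=
  forall j, (j <= r)%N -> (j <= m)%N -> weight (shift j c) (m - j) = 0.

Lemma annihilates_shift r m c :
  annihilates r.+1 m.+1 c -> annihilates r m (shift 1 c).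
Proof.
by move=> h j jr jm; rewrite -(h j.+1) // subSS.
Qed.

Lemma annihilates_le r m c : annihilates r.+1 m c -> annihilates r m c.
Proof. by move=> h j jr; apply: h; apply: leqW. Qed.

Lemma annihilates_weight r m c : annihilates r m c -> weight c m = 0.
Proof. by move/(_ 0%N isT isT); rewrite subn0. Qed.

(** Since the total weight is 0, it suffices to kill the odd part. If m is even, [sbin m j] is 0 for
    odd j; if m is odd, the odd part is the weight of [shift 1 c] at m - 1, the second condition. *)
Lemma annihilates_cut m c : annihilates 1 m c -> weight (cut false c) m = 0.
Proof.
move=> h; have h0 := annihilates_weight h.
suff h1 : weight (cut true c) m = 0.
  rewrite -{}[RHS]h0 -[LHS]addr0 -{}h1 /weight -big_split; apply: eq_bigr => j _ /=.
  by rewrite /cut; case: odd; rewrite /= mul0r ?add0r ?addr0.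
case: m h h0 => [|m] h _; first by rewrite /weight big_ord1 /cut /= mul0r.
case: (boolP (odd m)) => om.
  rewrite /weight big1 // => j _; rewrite /cut; case: (boolP (odd j)) => oj; rewrite ?mul0r //.
  by rewrite /= /sbin /= om oj mulr0.
rewrite -(h 1%N) // subSS subn0 /weight big_ord_recl /cut /= mul0r add0r.
apply: eq_bigr => j _; rewrite /bump /shift add1n /= sbin_evenS //=.
by case: (boolP (odd j)) => oj //=; rewrite mul0r /sbin om oj mulr0.
Qed.

End Weights.

Lemma sum_subset_U1 (R : zmodType) (T : finType) (k : T) (N : {set T})
    (G : {set T} -> R) : k \notin N ->
  \sum_(J : {set T} | J \subset k |: N) G J =
  \sum_(J : {set T} | J \subset N) (G J + G (k |: J)).
Proof.
move=> kN; rewrite (bigID (fun J : {set T} => k \in J)) /= addrC big_split /=.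
congr (_ + _).
  apply: eq_bigl => J; rewrite -subsetD1 setU1K //.
rewrite (reindex_onto (fun J => k |: J) (fun J => J :\ k)) /=; last first.
  by move=> J /andP[_ kJ]; rewrite setD1K.
apply: eq_bigl => J; rewrite setU11 andbT.
apply/andP/idP => [[sJ /eqP eJ]|sJ].
  have kJ : k \notin J by rewrite -eJ !inE eqxx.
  by rewrite -(setU1K kJ) -(setU1K kN) setSD.
have kJ : k \notin J by apply: contra kN => /(subsetP sJ).
by rewrite setUS // setU1K.
Qed.

(** * Signed shuffle sums of two spinors *)

Section Convolution.
Variables (F : fieldType) (n : nat).
Notation srow := {set 'I_n}.
Notation spinor := {ffun {set 'I_n} -> F^o}.
Implicit Types (M N J : srow) (t u : spinor) (k i : 'I_n) (c : nat -> F).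
Notation sg := (sg F).

Definition conv c M t u : F :=
  \sum_(J : srow | J \subset M) c #|J| * sg J (M :\: J) * u J * t (M :\: J).
(** A second name for [conv], to carry the linear structure in the other argument. *)
Definition convr c M u t : F := conv c M t u.

Lemma conv_is_scalar c M t : scalar (conv c M t).
Proof.
move=> s u v; rewrite /conv mulr_sumr -big_split; apply: eq_bigr => J _ /=.
by rewrite ffunE scale_ffunE; ring.
Qed.
HB.instance Definition _ c M t :=
  GRing.isLinear.Build F spinor F *%R (conv c M t) (conv_is_scalar c M t).

Lemma convr_is_scalar c M u : scalar (convr c M u).
Proof.
move=> s t v; rewrite /convr /conv mulr_sumr -big_split; apply: eq_bigr => J _ /=.
by rewrite ffunE scale_ffunE; ring.
Qed.
HB.instance Definition _ c M u :=
  GRing.isLinear.Build F spinor F *%R (convr c M u) (convr_is_scalar c M u).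

Lemma conv_notin k M t u c : k \notin M -> conv c M t (wedge k u) = 0.
Proof.
move=> kM; rewrite /conv big1 // => J /subsetP JM; rewrite ffunE ifN ?mulr0 ?mul0r //.
by apply: contra kM; apply: JM.
Qed.

Lemma convr_notin k M t u c : k \notin M -> conv c M (wedge k t) u = 0.
Proof.
move=> kM; rewrite /conv big1 // => J JM; rewrite ffunE ifN ?mulr0 ?mul0r //.
by apply: contra kM; rewrite inE => /andP[].
Qed.

Lemma setU1D k (N J : srow) : k \notin N -> (k |: N) :\: (k |: J) = N :\: J.
Proof.
move=> kN; apply/setP => x; rewrite !inE negb_or; case: (x =P k) => [->|] //=.
by rewrite (negPf kN) andbF.
Qed.

Lemma setU1Dr k (N J : srow) : k \notin J -> (k |: N) :\: J = k |: (N :\: J).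
Proof.
move=> kJ; apply/setP => x; rewrite !inE; case: (x =P k) => [->|] //=.
by rewrite kJ.
Qed.

Lemma sg_split k N J : J \subset N -> sg [set k] N = sg [set k] J * sg [set k] (N :\: J).
Proof.
move=> JN; rewrite -[X in sg _ X = _](setID N J) (setIidPr JN) sgUr //.
by rewrite disjoints_subset setCD subsetUr.
Qed.

Lemma conv_wedge k N t u c : k \notin N ->
  conv c (k |: N) t (wedge k u) = sg [set k] N * conv (shift 1 c) N t u.
Proof.
move=> kN; rewrite /conv sum_subset_U1 // mulr_sumr; apply: eq_bigr => J JN.
have kJ : k \notin J by apply: contra kN => /(subsetP JN).
have kNJ : k \notin N :\: J by rewrite inE (negPf kN) andbF.
rewrite !ffunE (negPf kJ) mulr0 mul0r add0r setU11 setU1K // setU1D // cardsU1 kJ.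
rewrite /shift add1n sgUl ?disjoint1 // sgUr ?disjoint1 // sg11 (sg_split k JN); ring.
Qed.

Lemma convr_wedge k N t u c : k \notin N ->
  conv c (k |: N) (wedge k t) u = sg [set k] N * conv (alter c) N t u.
Proof.
move=> kN; rewrite /conv sum_subset_U1 // mulr_sumr; apply: eq_bigr => J JN.
have kJ : k \notin J by apply: contra kN => /(subsetP JN).
have kNJ : k \notin N :\: J by rewrite inE (negPf kN) andbF.
rewrite !ffunE setU1D // (negPf kNJ) mulr0 addr0 setU1Dr // setU11 setU1K //.
rewrite /alter sgUr ?disjoint1 // sgUr ?disjoint1 // sg11 (sg_split k JN).
have : sg J [set k] = (-1) ^+ #|J| * sg [set k] J.
  have := sg_swap F (disjoint1 kJ); rewrite cards1 mul1n => <-.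
  by rewrite mulrAC sg_sqr mul1r.
by move=> ->; ring.
Qed.

Lemma conv_contr i N t u c : i \notin N ->
  sg [set i] N * conv c (i |: N) t u =
  conv (shift 1 c) N t (contr i u) + conv (alter c) N (contr i t) u.
Proof.
move=> iN; rewrite /conv sum_subset_U1 // mulr_sumr -big_split; apply: eq_bigr => J JN.
have iJ : i \notin J by apply: contra iN => /(subsetP JN).
have iNJ : i \notin N :\: J by rewrite inE (negPf iN) andbF.
rewrite !ffunE setU1D // (negPf iNJ) (negPf iJ) setU1Dr // cardsU1 iJ /shift add1n.
rewrite /alter sgUr ?disjoint1 // sgUl ?disjoint1 // (sg_split i JN).
have -> : sg J [set i] = (-1) ^+ #|J| * sg [set i] J.
  have := sg_swap F (disjoint1 iJ); rewrite cards1 mul1n => <-.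
  by rewrite mulrAC sg_sqr mul1r.
have e1 := sg_sqr F [set i] J; have e2 := sg_sqr F [set i] (N :\: J).
move: e1 e2; set x := sg [set i] J; set y := sg [set i] (N :\: J) => e1 e2 /=.
transitivity ((x * x) * ((-1) ^+ #|J| * c #|J| * sg J (N :\: J) * u J * (y * t (i |: N :\: J)))
  + (y * y) * (c #|J|.+1 * sg J (N :\: J) * (x * u (i |: J)) * t (N :\: J))); first by ring.
by rewrite e1 e2 !mul1r addrC.
Qed.

Lemma conv_par p M t u c : conv c M t (par p u) = conv (cut p c) M t u.
Proof.
apply: eq_bigr => J _; rewrite ffunE /cut.
by case: ifP => _; rewrite ?mulr0 ?mul0r.
Qed.

Lemma convr_par M t u c : conv c M (par false t) u = conv (cut (odd #|M|) c) M t u.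
Proof.
apply: eq_bigr => J JM; rewrite ffunE /cut cardsD (setIidPr JM) oddB ?subset_leq_card //.
by case: (odd #|M|); case: (odd #|J|); rewrite /= ?mulr0 ?mul0r.
Qed.

Section Pure.
Variable t : spinor.
Hypotheses (pt : pure_spinor t) (t0 : t set0 != 0).

Definition pfc i k : F := - contr k t [set i] / t set0.

Lemma pure_contr1 i :
  contr i t = \sum_k pfc i k *: wedge k t + (t [set i] / t set0) *: par false t.
Proof.
apply: (scalerI t0); rewrite pure_contr // scalerDr scaler_sumr scalerA.
rewrite [t set0 * _]mulrC divfK //; congr (_ + _); apply: eq_bigr => k _.
by rewrite scalerA /pfc [t set0 * _]mulrC divfK.
Qed.

(** A letter i of M is taken out as a contraction of either factor. By [pure_contr1] it becomes
    wedges by letters k, each of which takes k out as well. The coefficients are shifted twice if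
    both steps hit the first factor and unchanged if both hit the second: this is the recursion
    [weightSS]. *)
Lemma conv_pure c M : conv c M t t = weight c #|M| * t M * t set0.
Proof.
elim: {M}_.+1 {-2}M (ltnSn #|M|) c => // m IH M; rewrite ltnS => leM c.
have [->|[i iM]] := set_0Vmem M.
  rewrite cards0 /weight big_ord1 sbin0 mulr1 /conv (big_pred1 set0) => [|J].
    by rewrite setD0 cards0 sg0l mulr1.
  by rewrite subset0.
rewrite -(setD1K iM); set N := M :\ i.
have iN : i \notin N by rewrite !inE eqxx.
have cM : #|M| = #|N|.+1 by rewrite (cardsD1 i M) iM.
have ltN : (#|N| < m)%N by rewrite -ltnS -cM.
apply: (mulfI (x := sg [set i] N)); first by rewrite signr_eq0.
rewrite conv_contr // cardsU1 iN add1n.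
have -> : sg [set i] N * (weight c #|N|.+1 * t (i |: N) * t set0) =
    weight c #|N|.+1 * contr i t N * t set0.
  by rewrite ffunE (negPf iN); ring.
rewrite -[X in _ + X]/(convr _ _ _ _) pure_contr1 !linearD !linearZ /= !linear_sum /=.
rewrite addrACA -mulrDr /convr conv_par convr_par !IH // -mulrDl -mulrDl weight_cut.
rewrite ffunE sum_ffunE mulrDr mulrDl scale_ffunE; congr (_ + _); last first.
  by rewrite ffunE; case: ifP => _; rewrite ?mulr0 ?mul0r //=; ring.
rewrite -big_split mulr_sumr mulr_suml; apply: eq_bigr => k _ /=.
rewrite -[X in _ + X]/(convr _ _ _ _) !linearZ /= scale_ffunE -mulrDr.
have [kN|kN] := boolP (k \in N); last first.
  by rewrite /convr conv_notin // convr_notin // ffunE (negPf kN); ring.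
have kNk : k \notin N :\ k by rewrite !inE eqxx.
have cN : #|N| = #|N :\ k|.+1 by rewrite (cardsD1 k N) kN.
rewrite -{1 2}(setD1K kN) /convr conv_wedge // convr_wedge //.
have ltNk : (#|N :\ k| < m)%N by apply: leq_trans (ltnW ltN); rewrite cN.
rewrite !(IH _ ltNk) cN weightSS.
rewrite ffunE kN (sgD1 F k kN) sg11.
have -> : weight (alter (alter c)) #|N :\ k| = weight c #|N :\ k|.
  by apply: eq_weight => j; rewrite /alter signrMK.
have -> : weight (shift 1 (shift 1 c)) #|N :\ k| = weight (shift 2 c) #|N :\ k|.
  exact: eq_weight.
by ring.
Qed.

(* Degree at most r in the wedgings, the even projection also having degree 1:
   this degree is what the number of conditions in [annihilates] controls. *)
Inductive wedge_span : nat -> spinor -> Prop :=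
| wspan_id : wedge_span 0 t
| wspan_par : wedge_span 1 (par false t)
| wspan_wedge r k u : wedge_span r u -> wedge_span r.+1 (wedge k u)
| wspan0 r : wedge_span r 0
| wspanD r s u v : wedge_span r u -> wedge_span r v -> wedge_span r (s *: u + v)
| wspanS r u : wedge_span r u -> wedge_span r.+1 u.

Lemma wspan_sum r (s : 'I_n -> F) (G : 'I_n -> spinor) :
  (forall k, wedge_span r (G k)) -> wedge_span r (\sum_k s k *: G k).
Proof.
move=> h; elim/big_rec: _ => [|k u _ wu]; first exact: wspan0.
exact: wspanD.
Qed.

Lemma wspanZ r s u : wedge_span r u -> wedge_span r (s *: u).
Proof. by move=> wu; rewrite -[_ *: _]addr0; apply: wspanD => //; exact: wspan0. Qed.

Lemma wspan_add r u v : wedge_span r u -> wedge_span r v -> wedge_span r (u + v).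
Proof. by move=> wu wv; rewrite -[u]scale1r; apply: wspanD. Qed.

(** On t this is [pure_contr1], and commuting past a wedge only leaves a term of lower degree. The
    even projection does not cost a second degree of parity: its contraction is odd, so the term in
    [par false t] disappears. *)
Lemma wspan_contr i r u : wedge_span r u -> wedge_span r.+1 (contr i u).
Proof.
elim=> {r u} [||r k u wu IH|r|r s u v _ IHu _ IHv|r u _ IH].
- rewrite pure_contr1; apply: wspan_add; last by apply: wspanZ; exact: wspan_par.
  by apply: wspan_sum => k; apply: wspan_wedge; exact: wspan_id.
- have -> : contr i (par false t) = par true (contr i t) by rewrite par_contr.
  rewrite pure_contr1 linearD linearZ /= par_par mulr0n scaler0 addr0 linear_sum /=.
  under eq_bigr do rewrite linearZ /= par_wedge /=.
  by apply: wspan_sum => k; apply: wspan_wedge; exact: wspan_par.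
- rewrite contr_wedge -scaleN1r addrC; apply: wspanD; first exact: wspan_wedge.
  case: (i == k); rewrite ?mulr0n ?mulr1n; last exact: wspan0.
  by do 2!apply: wspanS.
- by rewrite linear0; exact: wspan0.
- by rewrite linearD linearZ /=; apply: wspanD.
- exact: wspanS.
Qed.

Lemma conv_span r u : wedge_span r u ->
  forall M c, annihilates r #|M| c -> conv c M t u = 0.
Proof.
elim=> {r u} [||r k u _ IH|r|r s u v _ IHu _ IHv|r u _ IH] M c h.
- by rewrite conv_pure (annihilates_weight h) !mul0r.
- by rewrite conv_par conv_pure (annihilates_cut h) !mul0r.
- have [kM|kM] := boolP (k \in M); last by rewrite conv_notin.
  rewrite -(setD1K kM) conv_wedge ?IH ?mulr0 ?inE ?eqxx //.
  by apply: annihilates_shift; rewrite (cardsD1 k M) kM in h.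
- by rewrite linear0.
- by rewrite linearD linearZ /= IHu // IHv // mulr0 addr0.
- by apply: IH; apply: annihilates_le.
Qed.

Lemma conv_contrs (s : seq 'I_n) M c : annihilates (size s) #|M| c ->
  conv c M t (foldr (@contr F n) t s) = 0.
Proof.
apply: conv_span; elim: s => [|i s IH] /=; first exact: wspan_id.
exact: wspan_contr.
Qed.

End Pure.
End Convolution.

(** * The coefficients of the shuffling polynomial *)

Lemma bin_trinomial s h r :
  ('C(s + h, h) * 'C(s + r, s + h) = 'C(s + r, s) * 'C(r, h))%N.
Proof.
have [rh|hr] := ltnP r h.
  by rewrite [X in (_ * X)%N]bin_small ?ltn_add2l // [X in _ = (_ * X)%N]bin_small // !muln0.
have e1 : ('C(s + h, h) * (h`! * s`!) = (s + h)`!)%N.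
  by rewrite -(bin_fact (leq_addl s h)) addnK.
have e2 : ('C(s + r, s + h) * ((s + h)`! * (r - h)`!) = (s + r)`!)%N.
  by rewrite -[(r - h)%N](subnDl s) bin_fact // leq_add2l.
have e3 : ('C(s + r, s) * (s`! * r`!) = (s + r)`!)%N.
  by rewrite -{2}[r](addKn s) bin_fact // leq_addr.
have e4 := bin_fact hr.
have p : (0 < h`! * s`! * (r - h)`!)%N by rewrite !muln_gt0 !fact_gt0.
apply/eqP; rewrite -(eqn_pmul2r p); apply/eqP.
transitivity ((s + r)`!).
  by rewrite -e2 -e1; ring.
by rewrite -e3 -e4; ring.
Qed.

(** Used to turn the binomial of the shuffling polynomial times the multiplicity of a shuffle into a
    factor free of h times [sbin r h]. *)
Lemma sbin_trinomial s h r :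
  (sbin (s + h) h * sbin (s + r) (s + h) = sbin (s + r) s * sbin r h)%N.
Proof.
rewrite /sbin !oddD !halfD.
case: (boolP (odd s)) => os; case: (boolP (odd h)) => oh; case: (boolP (odd r)) => odr;
  rewrite /= ?muln0 ?mul0n ?add0n //; exact: bin_trinomial.
Qed.

Section Shuffle_coefficients.
Variable F : fieldType.

Lemma sbin_pascal m k :
  (sbin m.+1 k.+1)%:R = (sbin m k)%:R + (-1) ^+ k.+1 * (sbin m k.+1)%:R :> F.
Proof.
rewrite -signr_odd; case: (boolP (odd m)) => om; last first.
  rewrite sbin_evenS //=; case: (boolP (odd k)) => ok; rewrite /= ?expr0 ?expr1.
    by rewrite [X in _ = X%:R + _]/sbin om ok /= add0r mul1r.
  by rewrite [X in _ + _ * X%:R]/sbin om /= ok mulr0 addr0.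
case: k => [|k] /=; first by rewrite !sbin1 sbin0 /= om /= expr1 mulN1r subrr.
case: (boolP (odd k)) => ok; rewrite /= ?expr0 ?expr1; last first.
  case: m om => //= p op; rewrite sbinSS natrD mul1r !sbin_evenS //=.
  by rewrite negbK (negPf ok).
rewrite -(@sbin_odd_pred m k.+2) //= ?negbK // mulN1r subrr.
by rewrite /sbin /= om /= ok.
Qed.

(** The Gaussian binomial by its Pascal rule. Unlike the quotient defining [qbinomial], whose
    denominator vanishes at -1 when k > 1, the recursion can be evaluated there. *)
Fixpoint gauss (m k : nat) : {poly F} :=
  match m, k with
  | _, 0 => 1
  | 0, _.+1 => 0
  | m'.+1, k'.+1 => gauss m' k' + 'X^(k'.+1) * gauss m' k'.+1
  end.

Lemma gaussP m k : gauss m k * \prod_(i < k) (1 - 'X^(i.+1)) = \prod_(i < k) (1 - 'X^(m - i)).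
Proof.
elim: m k => [|m IH] [|k] /=; try by rewrite !big_ord0 mulr1.
  by rewrite mul0r big_ord_recl /= subnn expr0 subrr mul0r.
rewrite [RHS]big_ord_recl /= subn0.
rewrite (eq_bigr (fun i : 'I_k => 1 - 'X^(m - i))) // mulrDl -mulrA IH.
rewrite big_ord_recr /= mulrA IH big_ord_recr /=.
have [km|mk] := leqP k m.
  have -> : m.+1 = (k.+1 + (m - k))%N by lia.
  by rewrite exprD; ring.
suff -> : \prod_(i < k) (1 - 'X^(m - i) : {poly F}) = 0 by rewrite !mul0r !mulr0 addr0.
by apply/eqP/prodf_eq0; exists (Ordinal mk); rewrite //= subnn expr0 subrr.
Qed.

Lemma qbinomialN1 m k : (qbinomial F m k).[-1] = (sbin m k)%:R.
Proof.
have -> : qbinomial F m k = gauss m k.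
  rewrite /qbinomial -gaussP mulpK //; apply/prodf_neq0 => i _.
  rewrite -oppr_eq0 opprB -size_poly_gt0 size_XnsubC //.
elim: m k => [|m IH] [|k] /=; rewrite ?hornerC ?sbin0 // ?[sbin 0 _]sbin_small //.
by rewrite hornerD hornerM hornerXn !IH sbin_pascal.
Qed.

(** The first exponent is the sign written in [Theta]. The second comes from exchanging H' with the
    part of J' outside K: their sizes are r + 1 - h and s + h, where r = |I|. *)
Definition shuffle_sign (s r h : nat) : F :=
  (-1) ^+ ((h * h.+1)./2 + (s + h) * (r + h).+1).

(* The coefficient of the shuffling polynomial on the terms whose first row
   receives j of the letters of H and J. *)
Definition shuffle_coef (s r j : nat) : F :=
  if (j < s)%N then 0 else shuffle_sign s r (j - s) * (sbin j (j - s))%:R.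

Lemma sign_congr (a b : nat) : odd a = odd b -> (-1) ^+ a = (-1) ^+ b :> F.
Proof. by rewrite -signr_odd => ->; rewrite signr_odd. Qed.

Lemma triangular_succ h : (h.+1 * h.+2)./2 = (h.+1 + (h * h.+1)./2)%N.
Proof.
have -> : (h.+1 * h.+2 = h.+1.*2 + h * h.+1)%N by rewrite -muln2; ring.
by rewrite halfD odd_double /= doubleK.
Qed.

(** The two terms of [sbin_pascal] are, up to a common sign, the coefficients with s lowered and
    with r lowered. *)
Lemma shuffle_coefS s r j : shift 1 (shuffle_coef s.+1 r.+1) j =
  (-1) ^+ r * (shuffle_coef s r.+1 j + shuffle_coef s.+1 r j).
Proof.
rewrite /shift add1n /shuffle_coef ltnS.
case: (ltngtP j s) => [js|sj|->]; first by rewrite leqW // addr0 mulr0.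
  have [h ->] : exists h, j = (s + h.+1)%N by exists (j - s).-1; lia.
  have -> : (s + h.+1 < s.+1)%N = false by lia.
  have -> : ((s + h.+1).+1 - s.+1 = h.+1)%N by lia.
  have -> : (s + h.+1 - s = h.+1)%N by lia.
  have -> : (s + h.+1 - s.+1 = h)%N by lia.
  rewrite sbin_pascal mulrDr addrC mulrDr; congr (_ + _).
    rewrite !mulrA; congr (_ * _); rewrite -!exprD; apply: sign_congr.
    rewrite !oddD !oddM /= !oddD /=; case: odd; case: odd; case: odd; case: odd => //.
  rewrite !mulrA; congr (_ * _); rewrite -!exprD; apply: sign_congr.
  rewrite triangular_succ !oddD !oddM /= !oddD /=.
  by case: odd; case: odd; case: odd; case: odd.
rewrite ltnSn !subnn addr0 !sbin0 !mulr1 /shuffle_sign -!exprD; apply: sign_congr.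
rewrite !oddD !oddM /= !oddD /=.
by case: odd; case: odd; case: odd.
Qed.

Lemma shuffle_coef0S r j : shift 1 (shuffle_coef 0 r.+1) j =
  (-1) ^+ r * shuffle_coef 0 r j.
Proof.
rewrite /shift add1n /shuffle_coef !ltn0 !subn0 mulrA.
have sbinnn k : sbin k k = 1%N by rewrite /sbin binn andNb.
rewrite !sbinnn !mulr1 /shuffle_sign -!exprD; apply: sign_congr.
rewrite triangular_succ !oddD !oddM /= !oddD /=.
by case: odd; case: odd; case: odd.
Qed.

Lemma weightD (c d : nat -> F) (x : F) m :
  weight (fun j => x * (c j + d j)) m = x * (weight c m + weight d m).
Proof.
by rewrite /weight -big_split mulr_sumr; apply: eq_bigr => j _ /=; ring.
Qed.

Lemma weightZ (c : nat -> F) (x : F) m : weight (fun j => x * c j) m = x * weight c m.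
Proof. by rewrite /weight mulr_sumr; apply: eq_bigr => j _ /=; ring. Qed.

(** For r = 0 there are two terms, opposite when s is even; for s odd the hypothesis fails. For r >
    0 the sign changes when h grows by 2, so the two weights in [weightSS] cancel. *)
Lemma weight_shuffle_sign s r : sbin (s + r.+1) s != 0%N ->
  weight (shuffle_sign s r) r.+1 = 0.
Proof.
case: r => [|r] h.
  rewrite /weight !big_ord_recl big_ord0 /= sbin0 /bump /= addn0 sbin1 /=.
  rewrite addr0 !mulr1 /shuffle_sign /= addn0 muln1 add0n.
  have es : ~~ odd s.
    apply: contraNN h => os; rewrite /sbin addn1 /= os //.
  rewrite -signr_odd (negPf es) expr0 -signr_odd oddD oddM /= addn1 /= es.
  by rewrite /= expr1 subrr.
rewrite weightSS -big_split /weight /= big1 // => j _; rewrite /shift.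
have -> : shuffle_sign s r.+1 (2 + j) = - shuffle_sign s r.+1 j.
  rewrite -mulN1r -[X in X * _]expr1 /shuffle_sign -exprD; apply: sign_congr.
  rewrite add2n !triangular_succ !oddD !oddM /= !oddD /=.
  by case: odd; case: odd; case: odd; case: odd.
by rewrite mulNr addNr.
Qed.

Lemma weight_shuffle s r : weight (shuffle_coef s r) (s + r.+1) = 0.
Proof.
rewrite /weight -addnS big_split_ord /= big1 ?add0r => [|j _]; last first.
  by rewrite /shuffle_coef ltn_ord mul0r.
transitivity ((sbin (s + r.+1) s)%:R * weight (shuffle_sign s r) r.+1).
  rewrite /weight mulr_sumr; apply: eq_bigr => h _.
  rewrite /shuffle_coef ltnNge leq_addr /= addKn -mulrA -natrM sbin_trinomial natrM.
  by rewrite mulrCA.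
have [->|nz] := eqVneq (sbin (s + r.+1) s) 0%N; first by rewrite mul0r.
by rewrite weight_shuffle_sign // mulr0.
Qed.

(** Condition 0 is [weight_shuffle]. By [shuffle_coefS], condition j + 1 combines the conditions j
    for the two pairs in which s or r is lowered by one; for s = 0 only r is lowered. *)
Lemma annihilates_shuffle s r : annihilates r (s + r.+1) (shuffle_coef s r).
Proof.
elim: r s => [|r IHr] s.
  by case=> // _ _; rewrite subn0; exact: weight_shuffle.
elim: s => [|s IHs] [|j] jr jm; try by rewrite subn0; exact: weight_shuffle.
  have := IHr 0%N j jr; rewrite !add0n in jm * => /(_ jm) IH.
  rewrite subSS (@eq_weight _ _ (fun i => (-1) ^+ r * shift j (shuffle_coef 0 r) i)).
    by rewrite weightZ IH mulr0.
  by move=> i; rewrite -(shuffle_coef0S r (j + i)) /shift add1n addSn.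
have jm' : (j <= s + r.+2)%N by rewrite addSn ltnS in jm.
have e : (s + r.+2 = s.+1 + r.+1)%N by rewrite addSnnS.
have E1 := IHs j (leqW jr) jm'; have E2 := IHr s.+1 j jr.
rewrite addSn subSS.
rewrite (@eq_weight _ _ (fun i => (-1) ^+ r *
  (shift j (shuffle_coef s r.+1) i + shift j (shuffle_coef s.+1 r) i))).
  by rewrite weightD E1 e E2 -?e // addr0 mulr0.
by move=> i; rewrite -(shuffle_coefS s r (j + i)) /shift add1n addSn.
Qed.

End Shuffle_coefficients.

(** * Values on rows and vanishing quadratic forms *)

Section Rows.
Variables (F : fieldType) (n : nat).
Notation srow := {set 'I_n}.
Notation spinor := {ffun {set 'I_n} -> F^o}.
Implicit Types (A B M : srow) (t u : spinor) (k : 'I_n) (I s : seq 'I_n).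

Fixpoint inv (s : seq 'I_n) : nat :=
  if s is k :: s' then (count (fun a : 'I_n => (a < k)%N) s' + inv s')%N else 0%N.

Lemma inv_sorted s : std_row s -> inv s = 0%N.
Proof.
elim: s => //= k s IH ps; rewrite (IH (path_sorted ps)) addn0.
apply/eqP; rewrite -leqn0 leqNgt -has_count; apply/hasPn => a sa.
have tr : transitive (fun a b : 'I_n => (a < b)%N) by move=> x y z; apply: ltn_trans.
by move/order_path_min: ps => /(_ tr)/allP/(_ a sa) /ltnW; rewrite leqNgt.
Qed.

Lemma std_row_enum A : std_row (enum A).
Proof.
rewrite /std_row {1}/enum_mem; apply: sorted_filter => [x y z|].
  exact: ltn_trans.
rewrite -enumT.
have : sorted ltn (map val (enum 'I_n)) by rewrite val_enum_ord iota_ltn_sorted.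
by rewrite sorted_map.
Qed.

Lemma count_cross k s : uniq s ->
  count (fun a : 'I_n => (a < k)%N) s = cross [set k] [set i in s].
Proof.
move=> us; rewrite /cross big_set1 -sum1_count big_mkcond /=.
rewrite [RHS](eq_bigl (fun i => i \in s)); last by move=> i; rewrite inE.
by rewrite -big_uniq //; apply: eq_bigr => i _; case: ltnP.
Qed.

Lemma inv_cat s1 s2 : uniq (s1 ++ s2) ->
  inv (s1 ++ s2) = (inv s1 + inv s2 + cross [set i in s1] [set i in s2])%N.
Proof.
elim: s1 => [|k s1 IH] /=; first by rewrite set_nil cross_set0l addn0.
case/andP=> ks us; rewrite IH // set_cons crossUl; last first.
  by rewrite disjoints1 inE; apply: contra ks; rewrite mem_cat => ->.
move: us; rewrite cat_uniq => /and3P[u1 _ u2].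
by rewrite count_cat (@count_cross k s2) //; ring.
Qed.

(* The value of t at x(I), for an arbitrary row I. *)
Definition rowval I t : F := if uniq I then (-1) ^+ inv I * t [set i in I] else 0.

Lemma rowval_is_scalar I : scalar (rowval I).
Proof.
move=> c t u; rewrite /rowval; case: ifP => _; last by rewrite mulr0 addr0.
by rewrite ffunE scale_ffunE; ring.
Qed.
HB.instance Definition _ I :=
  GRing.isLinear.Build F spinor F *%R (rowval I) (rowval_is_scalar I).

Lemma rowval_enum A t : rowval (enum A) t = t A.
Proof. by rewrite /rowval enum_uniq inv_sorted ?std_row_enum // mul1r set_enum. Qed.

Lemma rowval_cons k I t : rowval (k :: I) t = rowval I (contr k t).
Proof.
rewrite /rowval /=; case: (boolP (uniq I)) => uI; rewrite ?andbF // andbT.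
rewrite ffunE inE; case: (boolP (k \in I)) => kI; rewrite /= ?mulr0 //.
by rewrite count_cross // exprD set_cons /sg; ring.
Qed.

(* Right multiplication x(A) |-> x(Ak), a Lie algebra element: it is e_n + e_{n+1}
   when k is the last letter. *)
Definition rmul k t : spinor := [ffun A : srow => (-1) ^+ #|A| * contr k t A].

Lemma rmul_is_linear k : linear (rmul k).
Proof.
move=> s u v; apply/ffunP => A; rewrite ffunE [RHS]ffunE scale_ffunE.
by rewrite linearD linearZ /= ffunE scale_ffunE !(ffunE (fun B => (-1) ^+ #|B| * _)); ring.
Qed.
HB.instance Definition _ k :=
  GRing.isLinear.Build F spinor spinor *:%R (rmul k) (rmul_is_linear k).

Lemma rowval_rcons k I t : rowval (rcons I k) t = rowval I (rmul k t).
Proof.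
rewrite /rowval rcons_uniq; case: (boolP (uniq I)) => uI; rewrite ?andbF // andbT.
rewrite !ffunE inE; case: (boolP (k \in I)) => kI; rewrite /= ?mulr0 //.
rewrite -cats1 inv_cat; last by rewrite cats1 rcons_uniq kI.
rewrite /= !addn0 exprD -!mulrA; congr (_ * _).
have -> : [set i in I ++ [:: k]] = k |: [set i in I].
  by apply/setP => x; rewrite !inE mem_cat inE orbC.
have -> : [set i in [:: k]] = [set k] by apply/setP => x; rewrite !inE.
have kI' : k \notin [set i in I] by rewrite inE.
have := sg_swap F (disjoint1 kI'); rewrite cards1 mul1n => <-.
rewrite /sg; set x := (-1) ^+ _; set y := (-1) ^+ _.
have : y * y = 1 by rewrite -expr2 sqrr_sign.
set z := t _ => e; transitivity ((y * y) * (x * z)); first by rewrite e mul1r.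
by ring.
Qed.

Lemma rowval_cat I s t : rowval (I ++ s) t = rowval I (foldr rmul t s).
Proof.
elim: s I => [|k s IH] I /=; first by rewrite cats0.
by rewrite -cat_rcons IH rowval_rcons.
Qed.

Lemma rowval_contrs I s t : rowval (I ++ s) t = rowval s (foldr (@contr F n) t (rev I)).
Proof.
elim: I t => [|k I IH] t //=; rewrite rowval_cons IH rev_cons -cats1 foldr_cat //.
Qed.

Lemma rmulE k t : rmul k t = contr k (par true t) - contr k (par false t).
Proof.
apply/ffunP => A; rewrite !ffunE; case: (boolP (k \in A)) => kA.
  by rewrite mulr0 subr0.
rewrite cardsU1 kA add1n -signr_odd /=.
by case: (odd #|A|); rewrite /= ?expr1 ?expr0 ?mulr0 ?mulN1r ?mul1r ?sub0r ?subr0.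
Qed.

Lemma rmul_sqr k t : rmul k (rmul k t) = 0.
Proof.
rewrite rmulE (rmulE k t) !linearB /= !par_contr !contr_sqr.
by rewrite opprK !subr0 oppr0 !addr0.
Qed.

Hypothesis n2 : (2 : F) != 0.

(** By [rmulE] this is the composite of two exponentials treated in [pure_aP]; the cross term
    vanishes because [contr k] squares to zero. *)
Lemma pure_rmul k (s : F) t : pure_spinor t -> pure_spinor (t + s *: rmul k t).
Proof.
move=> pt; set t1 := t + s *: contr k (par true t).
have p1 : pure_spinor t1 by apply: pure_aP => //; exact: spinor_clifford.
have -> : t + s *: rmul k t = t1 + (- s) *: contr k (par false t1).
  rewrite /t1 !linearD !linearZ /= par_contr contr_sqr !scaler0 addr0.
  by rewrite rmulE scalerBr scaleNr addrA.
by apply: pure_aP => //; exact: spinor_clifford.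
Qed.

Definition bilinear_form (beta : spinor -> spinor -> F) :=
  (forall u, scalar (beta u)) /\ (forall u, scalar (beta^~ u)).

Definition vanishing_form (beta : spinor -> spinor -> F) :=
  forall t, pure_spinor t -> beta t t = 0.

Section Form.
Variable beta : spinor -> spinor -> F.
Hypothesis bb : bilinear_form beta.

Lemma form_expand (s : F) t u :
  beta (t + s *: u) (t + s *: u) =
  beta t t + s * (beta u t + beta t u) + s * s * beta u u.
Proof.
by rewrite [t + _]addrC bb.2 !bb.1; ring.
Qed.

Lemma form0 : beta 0 0 = 0.
Proof.
have := bb.1 0 (-1) 0 0; rewrite scaler0 addr0 => ->.
by rewrite mulN1r addNr.
Qed.

(** The derivative along the group of [rmul k], read off from the pure spinors with parameters 1 and
    -1. *)
Lemma vanishing_polar k : vanishing_form beta ->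
  vanishing_form (fun t u => beta (rmul k t) u + beta t (rmul k u)).
Proof.
move=> vb t pt; have := vb _ (pure_rmul k 1 pt); have := vb _ (pure_rmul k (-1) pt).
rewrite !form_expand vb //; set x := beta (rmul k t) t + beta t (rmul k t).
set y := beta (rmul k t) (rmul k t) => e1 e2.
have : 2 * x = 0.
  transitivity ((0 + 1 * x + 1 * 1 * y) - (0 + -1 * x + -1 * -1 * y)); first by ring.
  by rewrite e1 e2 subr0.
by move/eqP; rewrite mulf_eq0 (negPf n2) => /eqP.
Qed.

(** Induction on the size of a set A with t(A) nonzero. If t vanishes at A minus k, then t + s (rmul
    k t) does not, for every nonzero s; the form is quadratic in s along this line, so its value at
    s = 0 follows. *)
Lemma vanishing_dense : (3 : F) != 0 ->
  (forall t, pure_spinor t -> t set0 != 0 -> beta t t = 0) -> vanishing_form beta.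
Proof.
move=> n3 vb t pt; have [->|nt] := eqVneq t 0; first exact: form0.
have [A tA] : exists A, t A != 0.
  apply/existsP; apply: contraNT nt => /existsPn h; apply/eqP/ffunP => A.
  by rewrite ffunE; apply/eqP; rewrite -[_ == _]negbK; apply: h.
elim: {A}_.+1 {-2}A (ltnSn #|A|) t pt tA {nt} => // m IH A; rewrite ltnS => leA t pt tA.
have [A0|[k kA]] := set_0Vmem A; first by apply: vb; rewrite -?A0.
have ltA : (#|A :\ k| < m)%N by move: leA; rewrite (cardsD1 k A) kA.
have [t0|tn] := eqVneq (t (A :\ k)) 0; last exact: IH ltA _ pt tn.
have zero (s : F) : s != 0 -> beta (t + s *: rmul k t) (t + s *: rmul k t) = 0.
  move=> ns; apply: (IH _ ltA); first exact: pure_rmul.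
  rewrite ffunE t0 add0r scale_ffunE !ffunE !inE eqxx /= setD1K //.
  by rewrite !mulf_neq0 // signr_eq0.
(* Three nonzero parameters determine a quadratic polynomial p, with 3 p(0) = 3 p(1) + p(-1) -
   p(2). *)
have := zero 1 (oner_neq0 _); have := zero (-1); have := zero 2 n2.
rewrite oppr_eq0 oner_eq0 !form_expand => e2 /(_ isT) e1 e0.
set p0 := beta t t in e0 e1 e2 *.
set p1 := beta (rmul k t) t + beta t (rmul k t) in e0 e1 e2.
set p2 := beta (rmul k t) (rmul k t) in e0 e1 e2.
have : 3 * p0 = 0.
  transitivity (3 * (p0 + 1 * p1 + 1 * 1 * p2) + (p0 + -1 * p1 + -1 * -1 * p2)
    - (p0 + 2 * p1 + 2 * 2 * p2)); first by ring.
  by rewrite e0 e1 e2 mulr0 subr0 addr0.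
by move/eqP; rewrite mulf_eq0 (negPf n3) => /eqP.
Qed.

End Form.
End Rows.

(** * Bringing in the letters of K by derivations *)

Section Shuffles.
Variables (F : fieldType) (n : nat).
Notation srow := {set 'I_n}.
Notation spinor := {ffun {set 'I_n} -> F^o}.
Implicit Types (A B M : srow) (t u : spinor) (k : 'I_n) (I s : seq 'I_n).
Implicit Types (beta : spinor -> spinor -> F).
Hypotheses (n2 : (2 : F) != 0) (n3 : (3 : F) != 0).
Notation rmul := (@rmul F n).
Notation contr := (@contr F n).

Lemma bilinear_comp beta (L L' : {linear spinor -> spinor}) :
  bilinear_form beta -> bilinear_form (fun t u => beta (L t) (L' u)).
Proof.
by case=> bl br; split=> u c v w; rewrite linearP ?bl ?br.
Qed.

Lemma bilinear_polar beta k : bilinear_form beta ->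
  bilinear_form (fun t u => beta (rmul k t) u + beta t (rmul k u)).
Proof.
case=> bl br; split=> u c v w.
  by rewrite linearP !bl; ring.
by rewrite linearP !br; ring.
Qed.

(** The second derivative along [rmul k]: since [rmul k] squares to zero, only twice the mixed term
    survives. *)
Lemma vanishing_rmul2 beta k : bilinear_form beta -> vanishing_form beta ->
  vanishing_form (fun t u => beta (rmul k t) (rmul k u)).
Proof.
move=> bb vb t pt.
have := vanishing_polar n2 (bilinear_polar k bb) k (vanishing_polar n2 bb k vb) pt.
rewrite !rmul_sqr.
have -> : beta 0 t = 0.
  by have := bb.2 t (-1) 0 0; rewrite scaler0 addr0 => ->; rewrite mulN1r addNr.
have -> : beta t 0 = 0.
  by have := bb.1 t (-1) 0 0; rewrite scaler0 addr0 => ->; rewrite mulN1r addNr.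
rewrite add0r addr0 => e.
have /eqP : 2 * beta (rmul k t) (rmul k t) = 0 by rewrite -[RHS]e; ring.
by rewrite mulf_eq0 (negPf n2) => /eqP.
Qed.

Lemma vanishing_foldr2 beta s : bilinear_form beta -> vanishing_form beta ->
  vanishing_form (fun t u => beta (foldr rmul t s) (foldr rmul u s)).
Proof.
elim: s beta => [|k s IH] beta bb vb //=.
apply: (IH (fun t u => beta (rmul k t) (rmul k u))); last exact: vanishing_rmul2.
exact: bilinear_comp.
Qed.

Lemma bilinear_foldr2 beta s : bilinear_form beta ->
  bilinear_form (fun t u => beta (foldr rmul t s) (foldr rmul u s)).
Proof.
elim: s beta => [|k s IH] beta bb //=.
by apply: (IH (fun t u => beta (rmul k t) (rmul k u))); exact: bilinear_comp.
Qed.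

(** Leibniz rule for one derivation per letter of [s]: S collects the letters whose derivation falls
    on the first argument. *)
Lemma vanishing_shuffle beta s : uniq s -> bilinear_form beta -> vanishing_form beta ->
  vanishing_form (fun t u => \sum_(S : srow | S \subset [set i in s])
    beta (foldr rmul t [seq k <- s | k \in S]) (foldr rmul u [seq k <- s | k \notin S])).
Proof.
elim: s beta => [|k s IH] beta /=.
  move=> _ bb vb t pt; rewrite (big_pred1 set0) ?vb // => S.
  by rewrite set_nil subset0.
case/andP=> ks us bb vb t pt.
rewrite set_cons sum_subset_U1 ?inE //.
rewrite -[RHS](IH _ us (bilinear_polar k bb) (vanishing_polar n2 bb k vb) t pt).
apply: eq_bigr => S sS.
have kS : k \notin S by apply: contra ks => /(subsetP sS); rewrite inE.
rewrite (negPf kS) setU11 /= addrC; congr (_ + _); congr (beta _ _).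
  congr (rmul k (foldr _ _ _)); apply: eq_in_filter => i si.
  by rewrite !inE; case: (i =P k) si => // ->; rewrite (negPf ks).
congr (foldr _ _ _); apply: eq_in_filter => i si.
by rewrite !inE; case: (i =P k) si => // ->; rewrite (negPf ks).
Qed.

Definition row_form (c : nat -> F) (I : seq 'I_n) M t u : F :=
  \sum_(J : srow | J \subset M)
    c #|J| * sg F J (M :\: J) * rowval (I ++ enum J) t * rowval (enum (M :\: J)) u.

Lemma bilinear_row_form c I M : bilinear_form (row_form c I M).
Proof.
split=> u x v w; rewrite /row_form mulr_sumr -big_split; apply: eq_bigr => J _ /=.
  by rewrite linearP /=; ring.
by rewrite linearP /=; ring.
Qed.

(** The prefix I is [size I] successive contractions of the first spinor, which [conv_contrs]
    handles when t(emptyset) is nonzero. *)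
Lemma vanishing_row_form c I M : annihilates (size I) #|M| c ->
  vanishing_form (row_form c I M).
Proof.
move=> h; apply: (vanishing_dense n2 (bilinear_row_form c I M) n3) => t pt t0.
rewrite -size_rev in h; rewrite -[RHS](conv_contrs pt t0 h); apply: eq_bigr => J _.
by rewrite rowval_contrs !rowval_enum.
Qed.

Lemma filter_enum A (S : srow) : S \subset A -> [seq k <- enum A | k \in S] = enum S.
Proof.
move=> SA; rewrite /enum_mem -filter_predI.
by apply: eq_filter => i /=; rewrite andb_idr //; apply: (subsetP SA).
Qed.

Lemma filter_enumC A (S : srow) : [seq k <- enum A | k \notin S] = enum (A :\: S).
Proof.
rewrite /enum_mem -filter_predI.
by apply: eq_filter => i /=; rewrite [RHS]inE.
Qed.

Lemma pure_shuffle t I M (Z K : srow) (s : nat) : pure_spinor t -> (#|M| = s + (size I).+1)%N ->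
  \sum_(S : srow | S \subset K) \sum_(J : srow | J \subset M)
    shuffle_coef F s (size I) #|J| * sg F J (M :\: J) *
    rowval (I ++ enum J ++ enum Z ++ enum S) t *
    rowval (enum (M :\: J) ++ enum Z ++ enum (K :\: S)) t = 0.
Proof.
move=> pt cM.
have h : annihilates (size I) #|M| (shuffle_coef F s (size I)).
  by rewrite cM; exact: annihilates_shuffle.
have b0 := bilinear_row_form (shuffle_coef F s (size I)) I M.
have bb := bilinear_foldr2 (enum Z) b0.
have vb := vanishing_foldr2 (enum Z) b0 (vanishing_row_form h).
have := vanishing_shuffle (enum_uniq K) bb vb pt.
rewrite set_enum => e; rewrite -[RHS]e; apply: eq_bigr => S SK.
apply: eq_bigr => J JM; rewrite filter_enum // filter_enumC.
by rewrite !catA !rowval_cat.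
Qed.

End Shuffles.

(** * Signs of rows *)

Section Eps.
Variables (F : fieldType) (n : nat).
Implicit Types (I s : seq 'I_n).

Lemma std_row_codom m (f : 'I_m -> 'I_n) :
  std_row [seq f i | i <- enum 'I_m] <-> {homo f : i j / (i < j)%N}.
Proof.
have tr : transitive (fun a b : 'I_n => (a < b)%N) by move=> x y z; apply: ltn_trans.
split=> [ss i j ij|h]; last first.
  rewrite /std_row sorted_map; apply: (sub_sorted (e := fun i j : 'I_m => (i < j)%N)).
    by move=> i j; apply: h.
  by have := std_row_enum (setT : {set 'I_m}); rewrite enum_setT -enumT.
have := sorted_ltn_nth tr (f i) ss.
move=> /(_ i j); rewrite !inE size_map size_enum_ord !ltn_ord => /(_ isT isT ij).
have e (l : 'I_m) : nth i (enum 'I_m) l = l by apply: val_inj; rewrite /= nth_enum_ord.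
have fe (l : 'I_m) : nth (f i) [seq f x | x <- enum 'I_m] l = f l.
  by rewrite (nth_map i) ?size_enum_ord // e.
by rewrite !fe.
Qed.

Lemma card_ord_lt m c : (c <= m)%N -> #|[set i : 'I_m | (i < c)%N]| = c.
Proof.
move=> cm; rewrite cardsE -sum1_card /=.
by rewrite -(big_ord_widen m (fun=> 1%N) cm) sum1_card card_ord.
Qed.

Lemma sorting_perm I : uniq I -> exists s : 'S_(size I),
  std_row [seq tnth (in_tuple I) (s i) | i <- enum 'I_(size I)] /\
  odd_perm s = odd (inv I).
Proof.
elim: I => [|k I IH] /=.
  by move=> _; exists 1%g; rewrite odd_perm1; split=> //; apply/std_row_codom; case.
case/andP=> kI uI; have [s [/std_row_codom ss os]] := IH uI.
set f := fun i => tnth (in_tuple I) (s i) in ss.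
set p := count (fun a : 'I_n => (a < k)%N) I.
have pE : p = #|[set j | (f j < k)%N]|.
  rewrite /p -[X in count _ X](map_tnth_enum (in_tuple I)) count_map -sum1_count big_enum_cond.
  by rewrite cardsE -sum1_card (reindex_inj (@perm_inj _ s)).
have pm : (p <= size I)%N by exact: count_size.
have fp j : (f j < k)%N = (j < p)%N.
  apply/idP/idP => [fj|].
    rewrite -[(j < p)%N]/(j.+1 <= p)%N pE -[X in (X <= _)%N](@card_ord_lt (size I)) //.
    apply/subset_leq_card/subsetP => i; rewrite !inE ltnS leq_eqVlt.
    by case/orP=> [/eqP/val_inj -> //|/ss ij]; apply: ltn_trans fj.
  apply: contraLR; rewrite -!leqNgt => fj.
  rewrite pE -[X in (_ <= X)%N](@card_ord_lt (size I)) ?(ltnW (ltn_ord j)) //.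
  apply/subset_leq_card/subsetP => i; rewrite !inE => fi.
  rewrite ltnNge; apply: contraL fi => ji; rewrite -leqNgt (leq_trans fj) //.
  by move: ji; rewrite leq_eqVlt => /orP[/eqP/val_inj -> //|/ss /ltnW].
have kf j : (k < f j)%N = (p <= j)%N.
  rewrite [RHS]leqNgt -fp -leqNgt ltn_neqAle; apply: andb_idl => _.
  by apply: contraNneq kI => /val_inj ->; rewrite mem_tnth.
have pI : (p < (size I).+1)%N by rewrite ltnS.
(* The head k, of index 0, goes to position p, the number of smaller entries, which are also the
   inversions it creates. *)
exists (lift_perm (Ordinal pI) ord0 s); split; last first.
  by rewrite odd_lift_perm /= addbF os oddD.
have liftE j : tnth (in_tuple (k :: I)) (lift_perm (Ordinal pI) ord0 s (lift (Ordinal pI) j)) = f j.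
  by rewrite lift_perm_lift /f !(tnth_nth k).
have idE : tnth (in_tuple (k :: I)) (lift_perm (Ordinal pI) ord0 s (Ordinal pI)) = k.
  by rewrite lift_perm_id.
apply/std_row_codom => i j.
case: (unliftP (Ordinal pI) i) => [i'|] ->; case: (unliftP (Ordinal pI) j) => [j'|] ->;
  rewrite ?liftE ?idE ?ltnn //= /bump ?fp ?kf; [|lia|lia].
by move=> h; apply: ss; lia.
Qed.

Lemma epsE I : uniq I -> eps F I = (-1) ^+ inv I.
Proof.
move=> uI; have [s [ss os]] := sorting_perm uI.
rewrite /eps; case: pickP => [s' ss'|/(_ s)]; last by rewrite ss.
suff -> : s' = s by rewrite os signr_odd.
have tr : transitive (fun a b : 'I_n => (a < b)%N) by move=> x y z; apply: ltn_trans.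
have pe (r : 'S_(size I)) : perm_eq [seq tnth (in_tuple I) (r i) | i <- enum 'I_(size I)] I.
  rewrite -[X in perm_eq _ X](map_tnth_enum (in_tuple I)) (map_comp (tnth (in_tuple I)) r).
  apply: perm_map; apply: uniq_perm; rewrite ?(map_inj_uniq (@perm_inj _ r)) ?enum_uniq //.
  move=> i; rewrite mem_enum; apply/mapP; exists ((r^-1)%g i); rewrite ?mem_enum //.
  by rewrite permKV.
have e : [seq tnth (in_tuple I) (s' i) | i <- enum 'I_(size I)] =
         [seq tnth (in_tuple I) (s i) | i <- enum 'I_(size I)].
  apply: (sorted_eq tr) => //.
    by move=> x y /andP[xy yx]; have := ltn_trans xy yx; rewrite ltnn.
  by rewrite (permPl (pe s')) perm_sym.
apply/permP => i; have := congr1 (fun l => nth (tnth (in_tuple I) i) l i) e.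
have ei : nth i (enum 'I_(size I)) i = i by apply: val_inj; rewrite /= nth_enum_ord.
rewrite (nth_map i) ?size_enum_ord // ei (nth_map i) ?size_enum_ord // ei.
exact: (elimT (tuple_uniqP (in_tuple I)) uI).
Qed.

End Eps.

(** * Evaluation of the shuffling polynomial *)

Section Evaluation.
Variables (F : fieldType) (n : nat).
Notation srow := {set 'I_n}.
Notation spinor := {ffun {set 'I_n} -> F^o}.
Implicit Types (A B M : srow) (t u : spinor) (k : 'I_n) (I s : seq 'I_n).

Definition coords t : 'I_#|{: srow}| -> F := fun i => t (enum_val i).

Lemma xrow_eval I t : (Defs.xrow F I).@[coords t] = rowval I t.
Proof.
rewrite /Defs.xrow /rowval; case: ifP => uI; last by rewrite meval0.
by rewrite mevalZ mevalXU epsE // /coords enum_rankK.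
Qed.

Lemma rowval_enumU X Y A B t : [disjoint A & B] ->
  rowval (X ++ enum (A :|: B) ++ Y) t =
  sg F A B * rowval (X ++ enum A ++ enum B ++ Y) t.
Proof.
move=> dAB; have uAB : uniq (enum A ++ enum B).
  rewrite cat_uniq !enum_uniq andbT /=; apply/hasPn => x; rewrite !mem_enum => xB.
  by rewrite (disjointFl dAB).
have pe : perm_eq (enum (A :|: B)) (enum A ++ enum B).
  apply: uniq_perm => //; first exact: enum_uniq.
  by move=> x; rewrite mem_cat !mem_enum inE.
have pe2 : perm_eq (X ++ enum (A :|: B) ++ Y) (X ++ enum A ++ enum B ++ Y).
  by rewrite perm_cat2l catA perm_cat2r.
rewrite /rowval (perm_uniq pe2); case: ifP => u; last by rewrite mulr0.
have eS (s1 s2 : seq 'I_n) : perm_eq s1 s2 -> [set i in s1] = [set i in s2].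
  by move=> p; apply/setP => x; rewrite !inE (perm_mem p).
rewrite (eS _ _ pe2) mulrA; congr (_ * _).
have u' : uniq (X ++ enum (A :|: B) ++ Y) by rewrite (perm_uniq pe2).
move: u u'; rewrite [enum A ++ _]catA => u u'; rewrite !inv_cat //.
- rewrite !(inv_sorted (std_row_enum _)) (eS _ _ pe) !set_enum.
  rewrite -/(sg F A B) (eS (enum (A :|: B) ++ Y) ((enum A ++ enum B) ++ Y)); last first.
    by rewrite perm_cat2r.
  rewrite !add0n /sg -exprD; apply: sign_congr; rewrite !oddD.
  by do 5!case: (odd _).
- by move: u; rewrite cat_uniq => /and3P[].
- by move: u'; rewrite cat_uniq => /and3P[].
Qed.

Lemma eps_enum_cat A B : [disjoint A & B] -> eps F (enum A ++ enum B) = sg F A B.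
Proof.
move=> dAB; have uAB : uniq (enum A ++ enum B).
  rewrite cat_uniq !enum_uniq andbT /=; apply/hasPn => x; rewrite !mem_enum => xB.
  by rewrite (disjointFl dAB).
by rewrite epsE // inv_cat // !(inv_sorted (std_row_enum _)) !set_enum.
Qed.

Section Term.
Variables (I : seq 'I_n) (H J K : srow) (t : spinor).
Hypotheses (dHJ : [disjoint H & J]) (dHK : [disjoint H & K]).
Hypothesis cH : #|H| = (size I).+1.
Let Z := J :&: K.
Let M := (H :|: J) :\: Z.
Let K0 := K :\: Z.
Let s := #|J :\: K|.

Lemma card_M : #|M| = (s + (size I).+1)%N.
Proof.
have -> : M = H :|: (J :\: K).
  apply/setP => x; rewrite !inE; have := disjointFr dHJ (x := x).
  by have := disjointFr dHK (x := x); case: (x \in H) => [->|] //; case: (x \in J); case: (x \in K).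
rewrite cardsU -cH addnC; have -> : H :&: (J :\: K) = set0; last by rewrite cards0 subn0.
apply/eqP; rewrite setI_eq0; apply: disjointWr dHJ; exact: subsetDl.
Qed.

(** Splitting Z off from J' and from K2' leaves signs that combine into a factor independent of J0
    and S: those of H' and J0 against Z give [sg M Z], those of Z against S and its complement give
    [sg Z K0]. *)
Lemma theta_term (J0 S : srow) : J0 \subset M -> S \subset K0 ->
  let J' := J0 :|: Z in let H' := M :\: J0 in
  let h := (#|H| - #|H'|)%N in
  (if (#|H'| <= #|H|)%N && ([set i in I] :&: H \subset H') then
    (-1) ^+ ((h * h.+1) %/ 2) * (qbinomial F (s + h) h).[-1]
     * eps F (enum H' ++ enum J') * eps F (enum Z ++ enum S)
     * (rowval (I ++ enum J' ++ enum S) t * rowval (enum H' ++ enum (K :\: S)) t)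
   else 0) =
  (sg F M Z * sg F Z K0) *
  (shuffle_coef F s (size I) #|J0| * sg F J0 H' *
    rowval (I ++ enum J0 ++ enum Z ++ enum S) t *
    rowval (enum H' ++ enum Z ++ enum (K0 :\: S)) t).
Proof.
move=> J0M SK0 J' H' h.
have dMZ : [disjoint M & Z] by rewrite disjoints_subset /M setDE subsetIr.
have dZK0 : [disjoint Z & K0].
  by rewrite disjoint_sym disjoints_subset /K0 setDE subsetIr.
have dJZ : [disjoint J0 & Z] := disjointWl J0M dMZ.
have dHZ : [disjoint H' & Z] by apply: disjointWl dMZ; exact: subsetDl.
have dHJ0 : [disjoint H' & J0] by rewrite disjoints_subset /H' setDE subsetIr.
have MU : H' :|: J0 = M by rewrite setUC -{1}(setIidPr J0M) setID.
have cM : (#|J0| + #|H'| = s + #|H|)%N.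
  by rewrite cH -card_M -(cardsID J0 M) (setIidPr J0M).
case: ifP => [/andP[hH Z1]|].
  have jE : #|J0| = (s + h)%N by apply/eqP; rewrite -(eqn_add2r #|H'|) cM -addnA subnK.
  have HE : (#|H'| + h = (size I).+1)%N by rewrite -cH /h subnKC.
  rewrite rowval_enumU //.
  have -> : K :\: S = Z :|: (K0 :\: S).
    apply/setP => x; rewrite !inE; have := subsetP SK0 x; rewrite !inE.
    by case: (x \in S) => [/(_ isT)|]; case: (x \in J); case: (x \in K).
  have dZS : [disjoint Z & S] := disjointWr SK0 dZK0.
  have dZKS : [disjoint Z & K0 :\: S] by apply: disjointWr dZK0; exact: subsetDl.
  have := rowval_enumU (enum H') [::] t dZKS; rewrite !cats0 => ->.
  rewrite !eps_enum_cat //; last first.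
    by rewrite -setI_eq0 setIUr setU_eq0 !setI_eq0 dHJ0 dHZ.
  rewrite /J' (sgUr _ _ dJZ) qbinomialN1.
  have -> : sg F M Z = sg F H' Z * sg F J0 Z by rewrite -sgUl // MU.
  have -> : sg F Z K0 = sg F Z S * sg F Z (K0 :\: S).
    rewrite -sgUr; first by rewrite -{1}(setIidPr SK0) setID.
    by rewrite disjoint_sym disjoints_subset setDE subsetIr.
  rewrite /shuffle_coef jE ltnNge leq_addr /= addKn divn2.
  have -> : sg F H' J0 = (-1) ^+ ((s + h) * (size I + h).+1) * sg F J0 H'.
    have := sg_swap F dHJ0; rewrite jE.
    have -> : (-1) ^+ (#|H'| * (s + h)) = (-1) ^+ ((s + h) * (size I + h).+1) :> F.
      apply: sign_congr; rewrite !oddM /= !oddD.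
      have := congr1 odd HE; rewrite oddD /=.
      by case: (odd #|H'|); case: (odd h); case: (odd s); case: (odd (size I)).
    by move=> <-; rewrite -mulrA sg_sqr mulr1.
  rewrite /shuffle_sign exprD; ring.
(* Terms excluded from [Theta] vanish in the full shuffle too: if H' is larger than H, then |J0| < s
   and the coefficient is 0; otherwise a common letter of I and H lies in J0 and is repeated in the
   first row. *)
move/negbT; rewrite negb_and -ltnNge => /orP[hH|].
  rewrite /shuffle_coef; have -> : (#|J0| < s)%N by rewrite -(ltn_add2r #|H'|) cM ltn_add2l.
  by rewrite !mul0r mulr0.
case/subsetPn => z; rewrite !inE => /andP[zI zH] zH'.
have zM : z \in M.
  by rewrite !inE zH /= andbT negb_and (disjointFr dHJ zH).
have zJ : z \in J0 by apply: contraNT zH' => zJ; rewrite zJ; move: zM; rewrite !inE.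
rewrite [rowval (I ++ _) t](_ : _ = 0); first by rewrite mulr0 mul0r mulr0.
rewrite /rowval; case: ifP => //; rewrite cat_uniq => /and3P[_ /hasPn /(_ z)].
by rewrite mem_cat mem_enum zJ => /(_ isT); rewrite /= zI.
Qed.

(** J' and K1' determine H' and K2' as complements, and Z must lie in J' and avoid K1'; so the free
    parameters are J' without Z, a subset of M, and K1', a subset of K0. *)
Lemma theta_sum (G : srow -> srow -> srow -> srow -> F) :
  \sum_(J' : srow) \sum_(H' : srow) \sum_(K1 : srow) \sum_(K2 : srow |
     [&& (#|H'| <= #|H|)%N,
          [disjoint H' & J'] && (H' :|: J' == H :|: J),
          [disjoint K1 & K2] && (K1 :|: K2 == K),
          [set i in I] :&: H \subset H'
        & Z \subset J' :&: K2]) G J' H' K1 K2 =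
  \sum_(S : srow | S \subset K0) \sum_(J0 : srow | J0 \subset M)
    if (#|M :\: J0| <= #|H|)%N && ([set i in I] :&: H \subset M :\: J0) then
      G (J0 :|: Z) (M :\: J0) S (K :\: S) else 0.
Proof.
have dMZ : [disjoint M & Z] by rewrite disjoints_subset /M setDE subsetIr.
have ZHJ : Z \subset H :|: J by apply: subset_trans (subsetUr _ _); exact: subsetIl.
have complE (A B C : srow) : [disjoint A & B] && (A :|: B == C) = (B \subset C) && (A == C :\: B).
  apply/andP/andP => [[d /eqP <-]|[BC /eqP ->]].
    by rewrite subsetUr setDUl setDv setU0 (setDidPl d).
  split; first by rewrite disjoints_subset setDE subsetIr.
  by apply/eqP; rewrite setUC -{1}(setIidPr BC) setID.
transitivity (\sum_(J' : srow | (Z \subset J') && (J' \subset H :|: J)) \sum_(S : srow | S \subset K0)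
   if (#|(H :|: J) :\: J'| <= #|H|)%N && ([set i in I] :&: H \subset (H :|: J) :\: J') then
      G J' ((H :|: J) :\: J') S (K :\: S) else 0).
  rewrite [RHS]big_mkcond; apply: eq_bigr => J' _.
  rewrite (bigD1 ((H :|: J) :\: J')) //= [X in _ + X]big1 => [|H' nH]; last first.
    apply: big1 => K1 _; apply: big_pred0 => K2.
    by rewrite complE (negPf nH) andbF /= andbF.
  rewrite addr0; case: ifP => [/andP[ZJ' J'HJ]|nZ]; last first.
    apply: big1 => K1 _; apply: big_pred0 => K2; rewrite complE eqxx andbT.
    rewrite subsetI; apply: contraFF nZ.
    by case/andP=> _ /andP[JJ /andP[_ /andP[_ /andP[ZZ _]]]]; rewrite ZZ JJ.
  rewrite [RHS]big_mkcond; apply: eq_bigr => K1 _.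
  rewrite big_mkcond (bigD1 (K :\: K1)) //= [X in _ + X]big1 => [|K2 nK]; last first.
    case: ifP => // /andP[_ /andP[_ /andP[h _]]].
    by move: h; rewrite disjoint_sym setUC complE (negPf nK) andbF.
  rewrite addr0 complE eqxx J'HJ /= subsetI ZJ' /=.
  have -> : [disjoint K1 & K :\: K1] && (K1 :|: K :\: K1 == K) = (K1 \subset K).
    by rewrite disjoint_sym setUC complE eqxx andbT.
  rewrite /K0 !subsetD subsetIr /= [[disjoint Z & K1]]disjoint_sym.
  by case: (K1 \subset K); case: [disjoint K1 & Z]; rewrite /= ?andbT ?andbF.
rewrite exchange_big; apply: eq_bigr => S SK /=.
rewrite (reindex_onto (fun J0 => J0 :|: Z) (fun J' => J' :\: Z)) /=; last first.
  by move=> J' /andP[ZJ _]; rewrite setUC -{1}(setIidPr ZJ) setID.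
apply: eq_big => [J0|J0 _].
  rewrite subsetUr subUset ZHJ andbT /=; apply/andP/idP => [[JM /eqP e]|JM].
    by rewrite -e /M setDUl setDv setU0 setSD.
  split; first exact: subset_trans JM (subsetDl _ _).
  by rewrite setDUl setDv setU0; apply/eqP/setDidPl/(disjointWl JM).
suff -> : (H :|: J) :\: (J0 :|: Z) = M :\: J0 by [].
by rewrite /M setDDl [Z :|: _]setUC.
Qed.

End Term.
Hypotheses (n2 : (2 : F) != 0) (n3 : (3 : F) != 0).

Lemma Theta_eval (T : irow n * irow n) t : pure_spinor t ->
  is_tableau T -> std_row T.1 -> std_row T.2 -> ~~ std_tableau T ->
  (Theta F T).@[coords t] = 0.
Proof.
move=> pt hT hT1 hT2 nT.
have [eT sH _ [j [J1 [h [H1 [eJ eH hj]]]]]] := canonical_form_exists hT hT1 hT2 nT.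
set I := canI T in eT sH *; set J := canJ T in eT eJ *.
set H := canH T in eT sH eH *; set K := canK T in eT *.
have tr : transitive (fun a b : 'I_n => (a < b)%N) by move=> x y z; apply: ltn_trans.
have ir : irreflexive (fun a b : 'I_n => (a < b)%N) by move=> x; exact: ltnn.
rewrite eT /= in hT1 hT2.
have uHK : uniq (H ++ K) := sorted_uniq tr ir hT2.
have pHK := hT2; rewrite /std_row (sorted_pairwise tr) pairwise_cat in pHK.
have pIJ := hT1; rewrite /std_row (sorted_pairwise tr) pairwise_cat in pIJ.
case/and3P: pHK => _ pH _; case/and3P: pIJ => _ _ pJ.
have dHJ : [disjoint [set i in H] & [set i in J]].
  rewrite disjoints_subset; apply/subsetP => x; rewrite !inE => xH; apply/negP => xJ.
  have jx : (j <= x)%N.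
    move: xJ pJ; rewrite eJ inE => /orP[/eqP -> //|xJ] /= /andP[/allP /(_ x xJ) /ltnW //].
  have xh : (x <= h)%N.
    move: xH pH; rewrite eH mem_rcons inE => /orP[/eqP -> //|xH].
    by rewrite -cats1 pairwise_cat => /and3P[/allrelP /(_ x h xH)]; rewrite inE eqxx => /(_ isT)/ltnW.
  by have := leq_ltn_trans xh (leq_trans hj jx); rewrite ltnn.
have dHK : [disjoint [set i in H] & [set i in K]].
  rewrite disjoints_subset; apply/subsetP => x; rewrite !inE => xH; apply/negP => xK.
  by move: uHK; rewrite cat_uniq => /and3P[_ /hasPn /(_ x xK) /negP].
have cH : #|[set i in H]| = size H.
  rewrite cardsE; apply/card_uniqP; by move: uHK; rewrite cat_uniq => /and3P[].
have cH' : #|[set i in H]| = (size I).+1 by rewrite cH.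
rewrite /Theta -/I -/J -/H -/K raddf_sum /=.
under eq_bigr => J' _.
  rewrite raddf_sum /=; under eq_bigr => H' _.
    rewrite raddf_sum /=; under eq_bigr => K1 _.
      rewrite raddf_sum /=; under eq_bigr => K2 _.
        rewrite mevalZ /xT mevalM !xrow_eval /= -cH; over.
      over.
    over.
  over.
rewrite /= -cH theta_sum //.
under eq_bigr => S SK do under eq_bigr => J0 JM do rewrite theta_term //.
rewrite -[RHS](mulr0 (sg F (([set i in H] :|: [set i in J]) :\: ([set i in J] :&: [set i in K]))
   ([set i in J] :&: [set i in K]) *
   sg F ([set i in J] :&: [set i in K]) ([set i in K] :\: ([set i in J] :&: [set i in K])))).
rewrite -[in RHS](pure_shuffle n2 n3 ([set i in J] :&: [set i in K])
  ([set i in K] :\: ([set i in J] :&: [set i in K])) pt (card_M dHJ dHK cH')).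
by rewrite mulr_sumr; apply: eq_bigr => S _; rewrite mulr_sumr.
Qed.

Lemma xrow_homog I : Defs.xrow F I \is 1.-homog.
Proof.
rewrite /Defs.xrow; case: ifP => _; last exact: rpred0.
by apply: rpredZ; rewrite dhomogX /= mdeg1.
Qed.

Lemma Theta_homog (T : irow n * irow n) : Theta F T \is 2.-homog.
Proof.
do 4!apply: rpred_sum => ? _.
by apply: rpredZ; apply: (dhomogM (d := 1) (e := 1)); exact: xrow_homog.
Qed.

End Evaluation.

(** * The action of the spin group *)

Section Generators.
Variables (F : fieldType) (n : nat).
Notation srow := {set 'I_n}.
Notation spinor := {ffun {set 'I_n} -> F^o}.
Implicit Types (A B C : srow) (t u : spinor) (c d k : 'I_n).
Implicit Types (op : srow -> option srow).
Hypothesis n2 : (2 : F) != 0.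

(** The transpose of [row_op], acting on linear forms on the spin module; this is why e_n and
    e_{n+1} turn into contractions below. *)
Definition row_op_dual op t : spinor := [ffun B : srow => oapp t 0 (op B)].

Lemma has_letterE c (k : nat) I : k = c.+1 -> has_letter k I = (c \in I).
Proof.
move=> ->; apply/existsP/idP => [[j /andP[jI /eqP[/val_inj <-]]] //|cI].
by exists c; rewrite cI eqxx.
Qed.

Lemma letterE c (k : nat) : k = c.+1 -> letter n k = [set c].
Proof. by move=> ->; apply/setP => j; rewrite !inE. Qed.

Lemma sg_adjacent c d A : d = c.+1 :> nat -> c \notin A -> sg F [set d] A = sg F [set c] A.
Proof.
move=> dc cA; rewrite /sg /cross !big_set1; congr (_ ^+ _); apply: eq_bigr => y yA.
have : y != c by apply: contraNneq cA => <-.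
by rewrite -val_eqE /= dc; lia.
Qed.

Lemma sg_last c A : c.+1 = n -> c \notin A -> sg F [set c] A = (-1) ^+ #|A|.
Proof.
move=> cn cA; rewrite /sg /cross big_set1 -sum1_card; congr (_ ^+ _).
apply: eq_bigr => y yA; have : y != c by apply: contraNneq cA => <-.
by rewrite -val_eqE /=; have := ltn_ord y; lia.
Qed.

(** The signs of the contraction and of the wedge agree, as no letter lies between c and d. *)
Lemma e_row_lt c d t : d = c.+1 :> nat ->
  row_op_dual (e_row c.+1) t = wedge d (contr c t).
Proof.
move=> dc; apply/ffunP => A; rewrite !ffunE /e_row -{1}dc ltn_ord.
have cd : c != d by rewrite -val_eqE /= dc; lia.
rewrite (@has_letterE d c.+2) ?dc // (@has_letterE c c.+1) //.
rewrite (@letterE d c.+2) ?dc // (@letterE c c.+1) // !inE cd /=.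
case: (boolP (d \in A)) => dA //=; case: (boolP (c \in A)) => cA /=; first by rewrite mulr0.
have cAd : c \notin A :\ d by rewrite !inE negb_and cA orbT.
rewrite (sgD1 F d dA) sg11 mul1r (sg_adjacent dc cAd) mulrA sg_sqr mul1r.
by rewrite setUC.
Qed.

Lemma f_row_lt c d t : d = c.+1 :> nat ->
  row_op_dual (f_row c.+1) t = wedge c (contr d t).
Proof.
move=> dc; apply/ffunP => A; rewrite !ffunE /f_row -{1}dc ltn_ord.
have cd : d != c by rewrite -val_eqE /= dc; lia.
rewrite (@has_letterE d c.+2) ?dc // (@has_letterE c c.+1) //.
rewrite (@letterE d c.+2) ?dc // (@letterE c c.+1) // !inE cd /=.
case: (boolP (c \in A)) => cA //=; case: (boolP (d \in A)) => dA /=; first by rewrite mulr0.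
have cAc : c \notin A :\ c by rewrite !inE eqxx.
rewrite (sgD1 F c cA) sg11 mul1r (sg_adjacent dc cAc) mulrA sg_sqr mul1r.
by rewrite setUC.
Qed.

(** The last letter crosses all of A, and e_n acts on rows of odd size: hence the minus sign. *)
Lemma e_row_n c t : c.+1 = n ->
  row_op_dual (e_row n) t = - contr c (par false t).
Proof.
move=> cn; apply/ffunP => A; rewrite !ffunE /e_row ltnn eqxx.
rewrite (has_letterE _ (esym cn)) (letterE (esym cn)).
case: (boolP (c \in A)) => cA /=; first by rewrite oppr0.
rewrite cardsU1 cA add1n /= (sg_last cn cA) setUC -signr_odd.
by case: (odd #|A|); rewrite /= ?mulr0 ?oppr0 // expr1 mulN1r opprK.
Qed.

Lemma e_row_Sn c t : c.+1 = n ->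
  row_op_dual (e_row n.+1) t = contr c (par true t).
Proof.
move=> cn; apply/ffunP => A; rewrite !ffunE /e_row ltnNge leqnSn /= gtn_eqF //.
rewrite (has_letterE _ (esym cn)) (letterE (esym cn)).
case: (boolP (c \in A)) => cA //=.
rewrite cardsU1 cA add1n /= (sg_last cn cA) setUC -signr_odd.
by case: (odd #|A|); rewrite /= ?mulr0 // expr0 mul1r.
Qed.

Lemma f_row_n c t : c.+1 = n ->
  row_op_dual (f_row n) t = - wedge c (par true t).
Proof.
move=> cn; apply/ffunP => A; rewrite !ffunE /f_row ltnn eqxx.
rewrite (has_letterE _ (esym cn)) (letterE (esym cn)).
case: (boolP (c \in A)) => cA /=; last by rewrite oppr0.
have cAc : c \notin A :\ c by rewrite !inE eqxx.
rewrite (sgD1 F c cA) sg11 mul1r (sg_last cn cAc) -signr_odd.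
rewrite [#|A|](cardsD1 c) cA add1n /=.
by case: (odd _); rewrite /= ?mulr0 ?oppr0 // expr1 mulN1r opprK.
Qed.

Lemma f_row_Sn c t : c.+1 = n ->
  row_op_dual (f_row n.+1) t = wedge c (par false t).
Proof.
move=> cn; apply/ffunP => A; rewrite !ffunE /f_row ltnNge leqnSn /= gtn_eqF //.
rewrite (has_letterE _ (esym cn)) (letterE (esym cn)).
case: (boolP (c \in A)) => cA //=.
have cAc : c \notin A :\ c by rewrite !inE eqxx.
rewrite (sgD1 F c cA) sg11 mul1r (sg_last cn cAc) -signr_odd.
rewrite [#|A|](cardsD1 c) cA add1n /=.
by case: (odd _); rewrite /= ?mulr0 // expr0 mul1r.
Qed.

Record pure_generator (y : spinor -> spinor) : Prop := PureGenerator {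
  pgen_sqr : forall t, y (y t) = 0;
  pgen_pure : forall s t, pure_spinor t -> pure_spinor (t + s *: y t) }.

Lemma pgen_eq y z : y =1 z -> pure_generator z -> pure_generator y.
Proof. by move=> e [h1 h2]; split=> [t|s t pt]; rewrite !e //; apply: h2. Qed.

Lemma pgen_opp (y : {linear spinor -> spinor}) : pure_generator y -> pure_generator (fun t => - y t).
Proof.
case=> h1 h2; split=> [t|s t pt]; first by rewrite linearN opprK h1.
by rewrite scalerN -scaleNr; apply: h2.
Qed.

Notation cl := (spinor_clifford F n).

Lemma pgen_wc c d : c != d -> pure_generator (wedgeL F d \o contrL F c).
Proof.
move=> cd; split=> [t|s t pt] /=; first exact: (ba_sqr cl).
exact: (pure_ba cl).
Qed.

Lemma pgen_wp c p : pure_generator (wedgeL F c \o parL F n p).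
Proof. by split=> [t|s t pt] /=; [exact: (bP_sqr cl) | exact: (pure_bP cl)]. Qed.

Lemma pgen_cp c p : pure_generator (contrL F c \o parL F n p).
Proof.
split=> [t|s t pt] /=; first exact: (bP_sqr (clifford_swap cl)).
by apply: pure_aP => //; exact: cl.
Qed.

Lemma letter_index i : (0 < i)%N -> (i < n)%N ->
  exists c d, [/\ i = c.+1, d = c.+1 :> nat & c != d].
Proof.
case: i => // i _ i_n; exists (Ordinal (ltnW i_n)), (Ordinal i_n); split=> //.
by rewrite -val_eqE /=; lia.
Qed.

Lemma pgen_e i : (0 < n)%N -> (1 <= i <= n.+1)%N -> pure_generator (row_op_dual (e_row i)).
Proof.
move=> n0 /andP[i0]; rewrite leq_eqVlt => /orP[/eqP ->|].
  have cn : (Ordinal (eq_leq (prednK n0))).+1 = n := prednK n0.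
  by apply: pgen_eq (fun t => e_row_Sn t cn) _; exact: pgen_cp.
rewrite ltnS leq_eqVlt => /orP[/eqP ->|ilt].
  have cn : (Ordinal (eq_leq (prednK n0))).+1 = n := prednK n0.
  by apply: pgen_eq (fun t => e_row_n t cn) (pgen_opp (pgen_cp _ _)).
have [c [d [-> dc cd]]] := letter_index i0 ilt.
by apply: pgen_eq (fun t => e_row_lt t dc) _; exact: pgen_wc.
Qed.

Lemma pgen_f i : (0 < n)%N -> (1 <= i <= n.+1)%N -> pure_generator (row_op_dual (f_row i)).
Proof.
move=> n0 /andP[i0]; rewrite leq_eqVlt => /orP[/eqP ->|].
  have cn : (Ordinal (eq_leq (prednK n0))).+1 = n := prednK n0.
  by apply: pgen_eq (fun t => f_row_Sn t cn) _; exact: pgen_wp.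
rewrite ltnS leq_eqVlt => /orP[/eqP ->|ilt].
  have cn : (Ordinal (eq_leq (prednK n0))).+1 = n := prednK n0.
  by apply: pgen_eq (fun t => f_row_n t cn) (pgen_opp (pgen_wp _ _)).
have [c [d [-> dc cd]]] := letter_index i0 ilt.
by apply: pgen_eq (fun t => f_row_lt t dc) _; apply: pgen_wc; rewrite eq_sym.
Qed.

Notation dimS := #|{: srow}|.

Definition act_row t (A : 'M[F]_dimS) : spinor :=
  [ffun B : srow => \sum_C t C * A (enum_rank C) (enum_rank B)].

Lemma act_row1 t : act_row t 1%:M = t.
Proof.
apply/ffunP => B; rewrite ffunE (bigD1 B) //= mxE eqxx mulr1 big1 ?addr0 // => C CB.
by rewrite mxE (inj_eq enum_rank_inj) (negPf CB) mulr0.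
Qed.

Lemma act_rowM t (A A' : 'M[F]_dimS) : act_row t (A *m A') = act_row (act_row t A) A'.
Proof.
apply/ffunP => B; rewrite !ffunE.
transitivity (\sum_C \sum_D t C * A (enum_rank C) (enum_rank D) * A' (enum_rank D) (enum_rank B)).
  apply: eq_bigr => C _; rewrite mxE (reindex enum_rank) /=.
    by rewrite mulr_sumr; apply: eq_bigr => D _; rewrite mulrA.
  by exists enum_val => x _; rewrite ?enum_rankK ?enum_valK.
by rewrite exchange_big; apply: eq_bigr => D _; rewrite ffunE mulr_suml.
Qed.

Lemma act_row_op t s op :
  act_row t (1%:M + s *: row_op F op) = t + s *: row_op_dual op t.
Proof.
apply/ffunP => B; rewrite ffunE [RHS]ffunE scale_ffunE.
under eq_bigr do rewrite mxE mulrDr.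
rewrite big_split /=; congr (_ + _).
  by have /ffunP/(_ B) := act_row1 t; rewrite ffunE.
rewrite ffunE; under eq_bigr do rewrite !mxE !enum_rankK.
case: (op B) => [C|] /=; last by rewrite mulr0 big1 // => C _; rewrite !mulr0.
rewrite (bigD1 C) //= eqxx big1 ?addr0 => [|D DC]; first by rewrite /= mulr1 mulrC.
by rewrite [_ == _](_ : _ = false) ?mulr0 //; apply: contraNF DC => /eqP[->].
Qed.

Lemma row_op_sqr op : (forall t, row_op_dual op (row_op_dual op t) = 0) ->
  row_op F op *m row_op F op = 0.
Proof.
move=> sq; apply/matrixP => a b; rewrite [RHS]mxE.
pose t : spinor := [ffun A => (A == enum_val a)%:R].
have /ffunP/(_ (enum_val b)) := sq t.
rewrite !ffunE mxE => e.
rewrite -[RHS]e; case eb : (op (enum_val b)) => [B|] /=; last first.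
  by rewrite big1 // => j _; rewrite !mxE eb mulr0.
rewrite (bigD1 (enum_rank B)) //= big1 ?addr0 => [|j jB]; last first.
  rewrite !mxE eb [_ == Some (enum_val j)](_ : _ = false) ?mulr0 //.
  by apply: contraNF jB => /eqP[->]; rewrite enum_valK.
rewrite !mxE eb enum_rankK eqxx mulr1 ffunE.
by case: (op B) => [C|] //=; rewrite ffunE.
Qed.

(** An equivalence together with invertibility, so that the property passes to [invmx] in the
    inverse case of [in_spin]. *)
Definition preserves_pure (A : 'M[F]_dimS) : Prop :=
  A \in unitmx /\ forall t, pure_spinor t <-> pure_spinor (act_row t A).

Lemma preserves_exp op s : pure_generator (row_op_dual op) ->
  preserves_pure (1%:M + s *: row_op F op).
Proof.
move=> [sq pp]; have sq' := row_op_sqr sq.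
have inv1 : (1%:M + s *: row_op F op) *m (1%:M + (- s) *: row_op F op) = 1%:M.
  rewrite mulmxDl mul1mx mulmxDr mulmx1 -scalemxAl -scalemxAr sq' !scaler0 addr0.
  by rewrite scaleNr addrNK.
split; first by have [] := mulmx1_unit inv1.
move=> t; split=> [pt|]; first by rewrite act_row_op; apply: pp.
by move=> /(pp (- s)); rewrite -act_row_op -act_rowM inv1 act_row1.
Qed.

Lemma preserves_spin (g : spin_pair F n) : (0 < n)%N -> in_spin g -> preserves_pure g.2.
Proof.
move=> n0; elim=> {g} [i t hi|i t hi||g h _ [ug pg] _ [uh ph]|g _ [ug pg]] /=.
- exact: preserves_exp (pgen_e n0 hi).
- exact: preserves_exp (pgen_f n0 hi).
- by split=> [|t]; rewrite ?unitmx1 ?act_row1.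
- by split=> [|t]; rewrite ?unitmx_mul ?ug // act_rowM pg ph.
- split=> [|t]; first by rewrite unitmx_inv.
  by rewrite [X in _ <-> X]pg -act_rowM mulVmx // act_row1.
Qed.

End Generators.

(** * The base point of the grassmannian *)

Section BasePoint.
Variables (F : fieldType) (n : nat).
Notation V := 'cV[F]_(n.+1 + n.+1).

Lemma colE m (u : 'cV[F]_m) : u = \sum_j u j 0 *: delta_mx j 0.
Proof.
apply/matrixP => i k; rewrite ord1 summxE (bigD1 i) //= big1 ?addr0 => [|j ji].
  by rewrite !mxE !eqxx mulr1.
by rewrite !mxE eq_sym (negPf ji) mulr0.
Qed.

Lemma col_delta_l (j : 'I_n.+1) :
  delta_mx (lshift n.+1 j) 0 = col_mx (delta_mx j 0) 0 :> V.
Proof.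
apply/matrixP => i k; rewrite ord1 mxE; case: (splitP i) => i' e.
  have -> : i = lshift n.+1 i' by apply: val_inj.
  by rewrite col_mxEu mxE (inj_eq (@lshift_inj _ _)).
have -> : i = rshift n.+1 i' by apply: val_inj.
by rewrite col_mxEd mxE eq_rlshift.
Qed.

Lemma col_delta_r (j : 'I_n.+1) :
  delta_mx (rshift n.+1 j) 0 = col_mx 0 (delta_mx j 0) :> V.
Proof.
apply/matrixP => i k; rewrite ord1 mxE; case: (splitP i) => i' e.
  have -> : i = lshift n.+1 i' by apply: val_inj.
  by rewrite col_mxEu mxE eq_lrshift.
have -> : i = rshift n.+1 i' by apply: val_inj.
by rewrite col_mxEd mxE (inj_eq (@rshift_inj _ _)).
Qed.

Definition col_inl (u : 'cV[F]_n.+1) : V := col_mx u 0.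

Lemma col_inl_is_linear : linear col_inl.
Proof.
by move=> a u v; rewrite /col_inl scale_col_mx add_col_mx scaler0 addr0.
Qed.
HB.instance Definition _ :=
  GRing.isLinear.Build F 'cV[F]_n.+1 V *:%R col_inl col_inl_is_linear.

Lemma mem_V1 (v : V) : (v \in V1 F n) = (dsubmx v == 0).
Proof.
apply/idP/eqP => [|e].
  have: (V1 F n <= lker (linfun (@dsubmx F n.+1 n.+1 1)))%VS.
    apply/span_subvP => w /mapP[j _ ->]; rewrite memv_ker lfunE /=.
    by rewrite col_delta_l col_mxKd.
  by move/subvP => h /h; rewrite memv_ker lfunE => /eqP.
rewrite -(vsubmxK v) e -/(col_inl _) (colE (usubmx v)) linear_sum.
apply: memv_suml => j _; rewrite linearZ /= /col_inl -col_delta_l.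
apply: memvZ; apply: memv_span.
by apply/mapP; exists j; rewrite ?mem_enum.
Qed.

Lemma mem_V2 (v : V) : v \in V2 F n -> usubmx v = 0.
Proof.
have: (V2 F n <= lker (linfun (@usubmx F n.+1 n.+1 1)))%VS.
  apply/span_subvP => w /mapP[j _ ->]; rewrite memv_ker lfunE /=.
  by rewrite col_delta_r col_mxKu.
by move/subvP => h /h; rewrite memv_ker lfunE => /eqP.
Qed.

Lemma dim_V1 : \dim (V1 F n) = n.+1.
Proof.
have -> : V1 F n = (linfun col_inl @: fullv)%VS.
  apply/vspaceP => v; rewrite mem_V1; apply/eqP/memv_imgP => [e|[u _ ->]].
    by exists (usubmx v); rewrite ?memvf // lfunE /= /col_inl -{1}(vsubmxK v) e.
  by rewrite lfunE /= /col_inl col_mxKd.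
rewrite limg_dim_eq; first by rewrite dimvf /dim /= muln1.
apply/eqP; rewrite -subv0; apply/subvP => u; rewrite memv_cap => /andP[_].
rewrite memv_ker lfunE /= /col_inl memv0 => /eqP/(congr1 usubmx).
by rewrite col_mxKu linear0 => ->.
Qed.

Lemma lagr_V1 : lagr_gr (V1 F n).
Proof.
split; first exact: dim_V1.
  move=> u v; rewrite !mem_V1 => /eqP hu /eqP hv.
  rewrite /bilin -(vsubmxK u) -(vsubmxK v) hu hv tr_col_mx trmx0 /form_mx.
  by rewrite -mulmxA mul_block_col !mul0mx !mulmx0 !mul1mx add0r addr0 mul_row_col
    mulmx0 mul0mx addr0 mxE.
suff -> : (V1 F n :&: V2 F n)%VS = 0%VS by rewrite dimv0.
apply/eqP; rewrite -subv0; apply/subvP => v; rewrite memv_cap mem_V1 => /andP[/eqP d /mem_V2 u].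
by rewrite memv0 -(vsubmxK v) d u col_mx0.
Qed.

(** The right inverse [A], of the same block shape, supplies preimages inside [V1] and thus the
    reverse inclusion. *)
Lemma act_gr_V1 (g : spin F n) (A : 'M[F]_(n.+1 + n.+1)) : actV g *m A = 1%:M ->
  dlsubmx (actV g) = 0 -> dlsubmx A = 0 -> act_gr g (V1 F n) = V1 F n.
Proof.
have stab (B : 'M[F]_(n.+1 + n.+1)) v : dlsubmx B = 0 -> v \in V1 F n -> B *m v \in V1 F n.
  rewrite !mem_V1 => B0 /eqP v0.
  rewrite -(submxK B) -(vsubmxK v) B0 v0 mul_block_col col_mxKd.
  by rewrite mul0mx mulmx0 addr0.
move=> gA g0 A0; apply/eqP; rewrite eqEsubv; apply/andP; split; apply/subvP => v.
  by case/memv_imgP => w wV ->; rewrite lfunE /=; apply: stab.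
move=> vV; apply/memv_imgP; exists (A *m v); first exact: stab.
by rewrite lfunE /= mulmxA gA mul1mx.
Qed.

Lemma elem_mx_sqr k l : k != l -> elem_mx F n k l *m elem_mx F n k l = 0.
Proof.
move=> kl; apply/matrixP => i j; rewrite !mxE big1 // => x _; rewrite !mxE.
case: eqP => _; rewrite ?mul0r //; case: eqP => [->|_]; rewrite ?mul0r //.
by rewrite [l == k]eq_sym (negPf kl) mulr0.
Qed.

Lemma eV_sqr i : eV F n i *m eV F n i = 0.
Proof.
rewrite /eV; case: ifP => _; rewrite mulmx_block !mul0mx !mulmx0 !addr0 ?add0r.
  rewrite mulNmx mulmxN opprK !elem_mx_sqr ?block_mx0 //; lia.
by rewrite block_mx0.
Qed.

Lemma dlsub_exp i (s : F) : dlsubmx (1%:M + s *: eV F n i) = 0.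
Proof.
rewrite (scalar_mx_block n.+1 n.+1) /eV.
case: ifP => _; rewrite scale_block_mx add_block_mx block_mxKdl scaler0 addr0 //.
Qed.

Lemma parab_xe (i : 'I_n.+1) (s : F) : parab (xe i s).
Proof.
apply: (act_gr_V1 (A := 1%:M + (- s) *: eV F n i.+1)); rewrite ?dlsub_exp //.
rewrite /actV /= mulmxDl mul1mx mulmxDr mulmx1 -scalemxAl -scalemxAr eV_sqr !scaler0 addr0.
by rewrite scaleNr addrNK.
Qed.

Lemma frame_one : frame (V1 F n) (spin_one F n).
Proof.
have d1 : dlsubmx (1%:M : 'M[F]_(n.+1 + n.+1)) = 0.
  by rewrite (scalar_mx_block n.+1 n.+1) block_mxKdl.
by apply: (act_gr_V1 (A := 1%:M)); rewrite /actV /= ?mulmx1.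
Qed.

End BasePoint.

(** * Sections of the line bundle *)

Section Sections.
Variables (F : fieldType) (n : nat).
Hypotheses (n0 : (0 < n)%N) (n2 : (2 : F) != 0).
Notation srow := {set 'I_n}.
Notation spinor := {ffun {set 'I_n} -> F^o}.
Notation dimS := #|{: srow}|.
Variables (chi : spin F n -> F) (phi : 'cV[F]_dimS -> spin F n -> F).
Hypothesis hphi : spin_iso chi phi.

Lemma phi_linear a u v h : phi (a *: u + v) h = a * phi u h + phi v h.
Proof. by case: hphi. Qed.

Lemma phi0 h : phi 0 h = 0.
Proof.
by have := phi_linear (-1) 0 0 h; rewrite scaler0 addr0 => ->; rewrite mulN1r addNr.
Qed.

Lemma phi_sum (I : finType) (c : I -> F) (w : I -> 'cV[F]_dimS) h :
  phi (\sum_j c j *: w j) h = \sum_j c j * phi (w j) h.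
Proof.
by elim/big_rec2: _ => [|j x y _ <-]; [exact: phi0 | exact: phi_linear].
Qed.

(** Elements of [spin] carry a membership proof, but a regular function only sees the matrix
    entries. *)
Lemma phi_ext v g h : sval g = sval h -> phi v g = phi v h.
Proof.
case: hphi => _ /(_ v) [[p hp] _] _ _ _ e.
by rewrite !hp // /entries /actV /actS e.
Qed.

Notation ell v := (phi v (spin_one F n)).

Lemma phi_ell v h : phi v h = ell (invmx (actS h) *m v).
Proof.
case: hphi => _ _ /(_ (spin_inv h) v (spin_one F n)) e _ _.
rewrite /actS /= in e *; rewrite e; apply: phi_ext; rewrite /= !mulmx1 !invmxK.
by case: (sval h).
Qed.

(* The unipotent element exp(e_i) fixes the base point, so it acts on [ell] by a
   scalar, which is 1 because e_i is nilpotent. *)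
Lemma ell_eS (i : 'I_n.+1) v : ell (eS F n i.+1 *m v) = 0.
Proof.
have pg := pgen_e n2 n0 (index_ok i).
have [uS _] := preserves_exp 1 pg.
set kappa := chi (xe i 1).
have main w : ell w = kappa * (ell w + ell (eS F n i.+1 *m w)).
  case: hphi => _ /(_ ((1%:M + 1 *: eS F n i.+1) *m w)) [_ hs] _ _ _.
  have := hs _ (lagr_V1 F n) _ _ (frame_one F n) (parab_xe i 1).
  rewrite expr1 -/kappa => e.
  (* The section attached to exp(e_i) w is evaluated at exp(e_i) in two ways: equivariance gives
     [ell w], the section property gives [kappa] times its value at the identity. *)
  transitivity (phi ((1%:M + 1 *: eS F n i.+1) *m w) (spin_mul (spin_one F n) (xe i 1))).
    by rewrite [RHS]phi_ell /actS /= mul1mx mulmxA mulVmx // mul1mx.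
  rewrite e; congr (_ * _).
  by rewrite mulmxDl mul1mx scale1r addrC -[eS _ _ _ *m w]scale1r phi_linear mul1r scale1r addrC.
have e2 := main (eS F n i.+1 *m v).
rewrite mulmxA (row_op_sqr (pgen_sqr pg)) mul0mx phi0 addr0 in e2.
have /eqP : (1 - kappa) * ell (eS F n i.+1 *m v) = 0.
  by rewrite mulrBl mul1r -e2 subrr.
rewrite mulf_eq0 => /orP[|/eqP //]; rewrite subr_eq0 => /eqP k1.
have := main v; rewrite -k1 mul1r => /eqP.
by rewrite -subr_eq0 opprD addrA subrr sub0r oppr_eq0 => /eqP.
Qed.

Lemma eS_delta i (A B : srow) : e_row i B = Some A ->
  eS F n i *m delta_mx (enum_rank B) 0 = delta_mx (enum_rank A) 0 :> 'cV[F]_dimS.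
Proof.
move=> e; apply/matrixP => a b; rewrite ord1 mxE (bigD1 (enum_rank B)) //= big1 => [|j jB].
  rewrite !mxE enum_rankK e !eqxx mulr1 addr0 andbT.
  by rewrite -[in RHS](enum_valK a) (inj_eq enum_rank_inj) eq_sym.
by rewrite !mxE (negPf jB) mulr0.
Qed.

(** If the largest letter of A is not n, B is A with this letter raised by one; otherwise B is A
    without it, and the parity of B selects e_n or e_{n+1}. Hence [ell] vanishes on every x(A) with
    A nonempty. *)
Lemma e_row_reach (A : srow) : A != set0 ->
  exists (i : 'I_n.+1) (B : srow), e_row i.+1 B = Some A.
Proof.
case/set0Pn => x xA; pose m := [arg max_(y > x in A) (y : nat)].
have [mA mmax] : m \in A /\ forall y, y \in A -> (y <= m)%N.
  by rewrite /m; case: arg_maxnP.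
have [mn|mn] := ltnP m.+1 n; last first.
  have mE : m.+1 = n by apply/eqP; rewrite eqn_leq mn ltn_ord.
  have hl : has_letter n (A :\ m) = false.
    by rewrite (has_letterE (c := m)) // !inE eqxx.
  have eA : A :\ m :|: letter n n = A.
    by rewrite (letterE (c := m)) // setUC setD1K.
  case: (boolP (odd #|A :\ m|)) => o.
    (* The ordinal n - 1 stands for the Chevalley index n. *)
    exists (inord n.-1), (A :\ m); rewrite inordK ?prednK //.
    by rewrite /e_row ltnn eqxx hl o /= eA.
  exists ord_max, (A :\ m); rewrite /e_row /= ltnNge leqnSn /= gtn_eqF //.
  by rewrite hl o /= eA.
pose d : 'I_n := Ordinal mn.
have dA : d \notin A by apply/negP => /mmax /=; rewrite ltnn.
have md : m != d by rewrite -val_eqE /=; lia.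
exists (widen_ord (leqnSn n) m), (d |: A :\ m); rewrite /e_row /= mn.
rewrite (has_letterE (c := d)) // (has_letterE (c := m)) // (letterE (c := d)) //.
rewrite (letterE (c := m)) // !inE !eqxx (negPf md) /=; congr Some.
apply/setP => y; rewrite !inE; case: (y =P m) => [->|_]; first by rewrite mA orbT.
by case: (y =P d) => [->|_] /=; rewrite ?(negPf dA) ?orbF.
Qed.

Lemma ell_delta (A : srow) : A != set0 -> ell (delta_mx (enum_rank A) 0) = 0.
Proof. by case/e_row_reach => i [B /eS_delta <-]; exact: ell_eS. Qed.

Definition base_spinor : spinor :=
  [ffun A : srow => if A == set0 then ell (delta_mx (enum_rank set0) 0) else 0].

(** Every contraction and the odd part of this spinor are zero, so each product in [omega] has a
    vanishing factor. *)
Lemma base_pure : pure_spinor base_spinor.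
Proof.
have c0 k : contr k base_spinor = 0.
  apply/ffunP => A; rewrite !ffunE; case: ifP => // _.
  by rewrite ifN ?mulr0 //; apply/set0Pn; exists k; rewrite setU11.
have p0 : par true base_spinor = 0.
  by apply/ffunP => A; rewrite !ffunE; case: (eqVneq A set0) => [->|_]; rewrite ?cards0 //= if_same.
move=> f g; rewrite /omega /= p0 !linear0 !mul0r !mulr0 addr0 subr0.
by apply: big1 => k _; rewrite c0 !linear0 mul0r mulr0 addr0.
Qed.

Lemma phi_delta h i :
  phi (delta_mx i 0) h = coords (act_row base_spinor (invmx (actS h))) i.
Proof.
rewrite phi_ell (colE (_ *m _)) phi_sum /coords ffunE enum_valK.
rewrite (bigD1 (enum_rank set0)) //= big1 ?addr0 => [|j j0]; last first.
  rewrite -(enum_valK j) ell_delta ?mulr0 //.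
  by apply: contra j0 => /eqP <-; rewrite enum_valK.
rewrite (bigD1 set0) //= big1 ?addr0 => [|C /negPf C0]; last by rewrite ffunE C0 mul0r.
rewrite ffunE eqxx mulrC; congr (_ * _); rewrite mxE (bigD1 i) //= big1 ?addr0 => [|j ji].
  by rewrite !mxE !eqxx mulr1.
by rewrite !mxE (negPf ji) mulr0.
Qed.

Lemma pure_section h : pure_spinor (act_row base_spinor (invmx (actS h))).
Proof.
have [_ pp] := preserves_spin n2 n0 (svalP (spin_inv h)).
exact: (proj1 (pp base_spinor) base_pure).
Qed.

End Sections.

Theorem theorem15 (R : realType) (n : nat) (hn : (1 <= n)%N)
    (chi : spin R[i] n -> R[i]) (hchi : fund_character chi)
    (phi : 'cV[R[i]]_#|{: {set 'I_n}}| -> spin R[i] n -> R[i])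
    (hphi : spin_iso chi phi)
    (T : irow n * irow n) (hT : is_tableau T)
    (hT1 : std_row T.1) (hT2 : std_row T.2) (hnstd : ~~ std_tableau T) :
  mult_kernel phi (Theta R[i] T).
Proof.
have n2 : (2 : R[i]) != 0 by rewrite Num.Theory.pnatr_eq0.
have n3 : (3 : R[i]) != 0 by rewrite Num.Theory.pnatr_eq0.
split=> [|W _ h _]; first exact: Theta_homog.
rewrite /mult_sections (meval_eq _ (phi_delta hn n2 hphi h)).
by apply: (Theta_eval n2 n3) => //; exact: pure_section.
Qed.
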